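(* Let $0<r_1<r_2$, $N\ge 2$, and let $h:[r_1,r_2]\times[0,\infty)\to[0,\infty)$ be continuous with $h(t,0)=0$. Let $q$ and $f$ be defined from $h$ as in the context, and consider, for $\lambda>0$, the boundary value problem $$u''(t)+\lambda q(t)f(t,u(t))=0,\quad t\in(0,1),\qquad u(0)=0=u(1). \qquad (P_\lambda)$$ Assume there exist a continuous function $b:[0,1]\to[0,\infty)$, not identically zero, and positive constants $c,\delta,R$ with $c>1$ and $0<\delta<R$ such that (i) $f(t,u)\le b(t)u$ for all $u\in(0,\delta)$, uniformly in $t\in(0,1)$, and (ii) $f(t,u)\ge c\,b(t)u$ for all $u\ge R$, uniformly in $t\in(0,1)$. Then $(P_\lambda)$ has a positive solution for every $\lambda$ with $\frac{\lambda_{1,qb}}{c}<\lambda<\lambda_{1,qb}$.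
   Context: The problem $(P_\lambda)$ arises from radial solutions of $-\Delta v=\lambda h(|x|,v)$ in the annulus $\{x\in\mathbb{R}^N: r_1<|x|<r_2\}$, $v=0$ on the boundary. The functions $q$ and $f$ are defined as follows. If $N=2$: $q(t)=\left[r_2\left(\frac{r_1}{r_2}\right)^t\log\frac{r_2}{r_1}\right]^2$ and $f(t,u)=h\!\left(r_2\left(\frac{r_1}{r_2}\right)^t,u\right)$. If $N\ge 3$: with $A=\frac{(r_1r_2)^{N-2}}{r_2^{N-2}-r_1^{N-2}}$ and $B=\frac{r_2^{N-2}}{r_2^{N-2}-r_1^{N-2}}$, $q(t)=(N-2)^{-2}\frac{A^{2/(N-2)}}{(B-t)^{2(N-1)/(N-2)}}$ and $f(t,u)=h\!\left(\left(\frac{A}{B-t}\right)^{1/(N-2)},u\right)$. In either case $q$ is continuous on $[0,1]$ and bounded between positive constants there. A positive solution of $(P_\lambda)$ is a function $u\in C([0,1])\cap C^2(0,1)$ satisfying $(P_\lambda)$ with $u(t)>0$ for $t\in(0,1)$. For a continuous $m:[0,1]\to[0,\infty)$ that is positive on a set of positive measure, $\lambda_{1,m}$ denotes the first (smallest) eigenvalue of $-u''=\lambda m(t)u$ on $(0,1)$, $u(0)=u(1)=0$; its eigenfunction $\phi_{1,m}$ satisfies $\phi_{1,m}>0$ on $(0,1)$. Here $\lambda_{1,qb}$ is this eigenvalue with $m=qb$. *)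

(* Defs.v *)
From Stdlib Require Import Reals Lra.
From Coquelicot Require Import Coquelicot.
Open Scope R_scope.

Definition cont_on_closed (a b : R) (u : R -> R) : Prop :=
  forall t, a <= t <= b -> forall eps, 0 < eps -> exists d, 0 < d /\
    forall s, a <= s <= b -> Rabs (s - t) < d -> Rabs (u s - u t) < eps.

Definition C2_open01 (u u'' : R -> R) : Prop :=
  exists u' : R -> R, forall t, 0 < t < 1 ->
    is_derive u t (u' t) /\ is_derive u' t (u'' t) /\ continuous u'' t.

Definition cont_on_dom (r1 r2 : R) (h : R -> R -> R) : Prop :=
  forall t u, r1 <= t <= r2 -> 0 <= u -> forall eps, 0 < eps -> exists d, 0 < d /\
    forall t' u', r1 <= t' <= r2 -> 0 <= u' -> Rabs (t' - t) < d -> Rabs (u' - u) < d ->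
      Rabs (h t' u' - h t u) < eps.

Definition coefA (N : nat) (r1 r2 : R) : R :=
  (r1 * r2) ^ (N - 2) / (r2 ^ (N - 2) - r1 ^ (N - 2)).
Definition coefB (N : nat) (r1 r2 : R) : R :=
  r2 ^ (N - 2) / (r2 ^ (N - 2) - r1 ^ (N - 2)).

Definition radius (N : nat) (r1 r2 t : R) : R :=
  if (N =? 2)%nat then r2 * Rpower (r1 / r2) t
  else Rpower (coefA N r1 r2 / (coefB N r1 r2 - t)) (1 / INR (N - 2)).

Definition qfun (N : nat) (r1 r2 t : R) : R :=
  if (N =? 2)%nat then (r2 * Rpower (r1 / r2) t * ln (r2 / r1)) ^ 2
  else / (INR (N - 2)) ^ 2 * Rpower (coefA N r1 r2) (2 / INR (N - 2))
       / Rpower (coefB N r1 r2 - t) (2 * INR (N - 1) / INR (N - 2)).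

Definition ffun (N : nat) (r1 r2 : R) (h : R -> R -> R) (t u : R) : R :=
  h (radius N r1 r2 t) u.

Definition is_eigenvalue (m : R -> R) (lam : R) : Prop :=
  exists u u'' : R -> R, cont_on_closed 0 1 u /\ C2_open01 u u'' /\
    (forall t, 0 < t < 1 -> - u'' t = lam * m t * u t) /\
    u 0 = 0 /\ u 1 = 0 /\ (exists t, 0 <= t <= 1 /\ u t <> 0).

Definition is_first_eigenvalue (m : R -> R) (lam : R) : Prop :=
  is_eigenvalue m lam /\ forall mu, is_eigenvalue m mu -> lam <= mu.

Definition positive_solution (q : R -> R) (f : R -> R -> R) (lam : R) (u : R -> R) : Prop :=
  exists u'' : R -> R, cont_on_closed 0 1 u /\ C2_open01 u u'' /\
    (forall t, 0 < t < 1 -> u'' t + lam * q t * f t (u t) = 0) /\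
    u 0 = 0 /\ u 1 = 0 /\ (forall t, 0 < t < 1 -> 0 < u t).

(* Main.v *)
(** Shooting: among the solutions of the initial value problem u(0) = 0,
    u'(0) = s, those with small s > 0 are positive on (0, 1] (Sturm comparison
    with the linear equation, using lambda < lambda_1), while those with large s
    vanish before t = 1 (Wronskian comparison with an eigenfunction on one of its
    nodal intervals, using c lambda > lambda_1).  As f is only continuous, the
    initial value problem is not uniquely solvable; so the intermediate value
    theorem is applied to the Euler schemes, which depend continuously on s, and
    their limit along a free ultrafilter on the step number solves the
    boundary value problem.  The same shooting argument in the eigenvalue
    parameter shows that the linear equation with lambda < lambda_1 has a
    solution positive on (0, 1]. *)

Require Import Defs.
From Stdlib Require Import Reals Lra Lia ZArith ClassicalEpsilon.
From Coquelicot Require Import Coquelicot.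
From mathcomp Require classical_sets filter.
Open Scope R_scope.

(** * Limits along an ultrafilter *)

(** The nonlinearity is extended by 0 to u <= 0 and the time is clamped to [0, 1], so the right-hand
    side is nonnegative everywhere and every solution of the initial value problem is concave.
    Concavity does three jobs. It bounds solutions and Euler polygons from above by the initial
    slope, so arbitrarily fast growth of f in u does no harm. It turns V(1) = 0 with positive
    initial slope into positivity inside, so V(1) is the only quantity to track. For large slopes it
    carries the size of a solution from its maximum to a window where weight times eigenfunction is
    positive; this is necessary because the weight may vanish on parts of the nodal interval.

    The ultrafilter takes the place of Arzela-Ascoli: it picks the limits at all times t at once,
    together with the limit of the shooting parameters, with no subsequence to extract. The initial
    value problem carries both a multiplier k and a slope s, so that one shooting lemma serves the
    slope (k = 1, with lambda absorbed into the right-hand side) and the eigenvalue parameter (s =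
    1). *)

Record free_ultrafilter (U : (nat -> Prop) -> Prop) : Prop := {
  uf_and : forall A B : nat -> Prop, U A -> U B -> U (fun n => A n /\ B n);
  uf_imp : forall A B : nat -> Prop, (forall n, A n -> B n) -> U A -> U B;
  uf_ex : forall A : nat -> Prop, U A -> exists n, A n;
  uf_em : forall A : nat -> Prop, U A \/ U (fun n => ~ A n);
  uf_tail : forall N, U (fun n => (N <= n)%nat) }.

(** An ultrafilter refining the cofinite filter [F]. The dichotomy [uf_em] comes from maximality: if
    no member of U avoids A, then U and A generate a proper filter [G] containing U, so G = U and A
    belongs to it. *)
Lemma free_ultrafilter_exists : exists U, free_ultrafilter U.
Proof.
pose (F := fun A : nat -> Prop => exists N, forall n, (N <= n)%nat -> A n).
assert (HF : filter.ProperFilter F).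
{ constructor.
  - intros [N HN]. exact (HN N (le_n N)).
  - constructor.
    + exists O. intros n _. exact I.
    + intros A B [N HN] [M HM]. exists (N + M)%nat. intros n Hn.
      split; [apply HN | apply HM]; lia.
    + intros A B HAB [N HN]. exists N. intros n Hn. apply HAB, HN, Hn. }
destruct (filter.ultraFilterLemma HF) as [U [HU HFU]].
assert (PU := @filter.ultra_proper _ _ HU).
destruct (PU) as [Une [UT UI US]].
exists U. constructor.
- intros A B HA HB. exact (UI A B HA HB).
- intros A B HAB HA. exact (US A B HAB HA).
- intros A HA. apply NNPP. intros Hn. apply Une.
  apply (US A); [|exact HA]. intros n Hx. apply Hn. exists n. exact Hx.
- intros A. destruct (classic (exists B, U B /\ forall n, B n -> ~ A n)) as [[B [HB HBA]]|Hno].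
  + right. exact (US B _ HBA HB).
  + left. pose (G := fun C : nat -> Prop => exists B, U B /\ forall n, B n -> A n -> C n).
    assert (HG : filter.ProperFilter G).
    { constructor.
      - intros [B [HB HBA]]. apply Hno. exists B. split; [exact HB|].
        intros n Hb Ha. exact (HBA n Hb Ha).
      - constructor.
        + exists (fun _ => True). split; [exact UT|]. intros; exact I.
        + intros C D [B [HB HC]] [B' [HB' HD]].
          exists (fun n => B n /\ B' n). split; [exact (UI B B' HB HB')|].
          intros n [h1 h2] ha. split; [apply HC | apply HD]; assumption.
        + intros C D HCD [B [HB HC]]. exists B. split; [exact HB|].
          intros n hb ha. apply HCD, HC; assumption. }
    assert (E : G = U).
    { apply (@filter.max_filter _ _ HU); [exact HG|].
      intros C HC. exists C. split; [exact HC|]. intros n h _; exact h. }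
    rewrite <- E. exists (fun _ => True). split; [exact UT|]. intros n _ h; exact h.
- intros N. apply HFU. exists N. intros n h; exact h.
Qed.

Definition ulim (U : (nat -> Prop) -> Prop) (x : nat -> R) (l : R) : Prop :=
  forall eps, 0 < eps -> U (fun n => Rabs (x n - l) < eps).

(** The limit is the supremum of the r with r <= x n for U-almost all n; [uf_em] decides for each
    threshold on which side almost all terms lie. *)
Lemma ulim_exists U (HU : free_ultrafilter U) (x : nat -> R) (K : R) :
  (forall n, Rabs (x n) <= K) -> exists l, ulim U x l.
Proof.
intros HK.
pose (E := fun r => U (fun n => r <= x n)).
assert (HE : bound E).
{ exists K. intros r Hr. destruct (uf_ex _ HU _ Hr) as [n Hn].
  generalize (HK n) (Rle_abs (x n)); lra. }
assert (HE' : exists r, E r).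
{ exists (- K). apply (uf_imp _ HU (fun n => (0 <= n)%nat)); [|apply uf_tail, HU].
  intros n _. generalize (HK n). unfold Rabs; destruct (Rcase_abs (x n)); lra. }
destruct (completeness E HE HE') as [l [Hub Hlub]].
exists l. intros eps Heps.
assert (H1 : U (fun n => x n < l + eps)).
{ destruct (uf_em _ HU (fun n => l + eps <= x n)) as [h|h].
  - assert (l + eps <= l) by (apply Hub; exact h). lra.
  - apply (uf_imp _ HU (fun n => ~ l + eps <= x n)); [|exact h]. intros n; lra. }
assert (H2 : exists r, E r /\ l - eps < r).
{ apply NNPP. intros Hno. assert (l <= l - eps); [|lra].
  apply Hlub. intros r Hr. apply Rnot_lt_le. intros h. apply Hno. exists r; split; assumption. }
destruct H2 as [r [Hr Hlr]].
apply (uf_imp _ HU (fun n => r <= x n /\ x n < l + eps)); [|apply uf_and; assumption].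
intros n [h1 h2]. apply Rabs_def1; lra.
Qed.

Lemma ulim_const U (HU : free_ultrafilter U) (c : R) : ulim U (fun _ => c) c.
Proof.
intros eps Heps. apply (uf_imp _ HU (fun n => (0 <= n)%nat)); [|apply uf_tail, HU].
intros n _. rewrite Rminus_diag. rewrite Rabs_R0. exact Heps.
Qed.

Lemma ulim_le U (HU : free_ultrafilter U) x y a b :
  U (fun n => x n <= y n) -> ulim U x a -> ulim U y b -> a <= b.
Proof.
intros Hle Hx Hy. apply Rnot_lt_le. intros Hab.
destruct (uf_ex _ HU _ (uf_and _ HU _ _ Hle (uf_and _ HU _ _ (Hx ((a-b)/2) ltac:(lra)) (Hy ((a-b)/2) ltac:(lra))))) as [n [h1 [h2 h3]]].
apply Rabs_def2 in h2. apply Rabs_def2 in h3. lra.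
Qed.

Lemma ulim_ext U (HU : free_ultrafilter U) x y a b :
  (forall n, x n = y n) -> ulim U x a -> ulim U y b -> a = b.
Proof.
intros E Hx Hy.
assert (T : forall A : nat -> Prop, (forall n, A n) -> U A).
{ intros A HA. apply (uf_imp _ HU (fun n => (0 <= n)%nat)); [intros; apply HA|apply uf_tail, HU]. }
apply Rle_antisym.
- apply (ulim_le U HU x y); [apply T; intros n; rewrite E; apply Rle_refl|assumption|assumption].
- apply (ulim_le U HU y x); [apply T; intros n; rewrite E; apply Rle_refl|assumption|assumption].
Qed.

Lemma ulim_continuous U (HU : free_ultrafilter U) f x a :
  continuity_pt f a -> ulim U x a -> ulim U (fun n => f (x n)) (f a).
Proof.
intros Hf Hx eps Heps. destruct (Hf eps Heps) as [d [Hd Hfd]].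
apply (uf_imp _ HU (fun n => Rabs (x n - a) < d)); [|apply Hx; exact Hd].
intros n Hn. destruct (Req_dec a (x n)) as [<-|Hne].
- rewrite Rminus_diag, Rabs_R0. exact Heps.
- apply Hfd. split; [split; [exact I | exact Hne]|exact Hn].
Qed.

(** * Euler schemes and shooting *)

Definition step (n : nat) : R := / INR (S n).

Definition cell (n : nat) (t : R) : nat := Z.to_nat (Int_part (t * INR (S n))).

Lemma step_pos n : 0 < step n.
Proof. apply Rinv_0_lt_compat, lt_0_INR. lia. Qed.

Lemma step_INR n : INR (S n) * step n = 1.
Proof. unfold step. apply Rinv_r. apply not_0_INR. lia. Qed.

Lemma step_small U (HU : free_ultrafilter U) eps : 0 < eps -> U (fun n => step n < eps).
Proof.
intros Heps. destruct (archimed_cor1 eps Heps) as [N [HN HN0]].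
apply (uf_imp _ HU (fun n => (N <= n)%nat)); [|apply uf_tail, HU].
intros n Hn. apply Rle_lt_trans with (/ INR N); [|exact HN].
apply Rinv_le_contravar; [apply lt_0_INR; lia | apply le_INR; lia].
Qed.

Lemma cell_bounds n t : 0 <= t -> INR (cell n t) * step n <= t < INR (cell n t) * step n + step n.
Proof.
intros Ht. unfold cell.
assert (Hn : 0 < INR (S n)) by (apply lt_0_INR; lia).
set (r := t * INR (S n)).
assert (Hr : 0 <= r) by (apply Rmult_le_pos; lra).
destruct (base_Int_part r) as [h1 h2].
assert (hz : (0 <= Int_part r)%Z).
{ assert (IZR (-1) < IZR (Int_part r)) by (simpl; lra). apply lt_IZR in H. lia. }
rewrite INR_IZR_INZ, Z2Nat.id by exact hz.
assert (Et : t = r * step n) by (unfold r; rewrite Rmult_assoc, step_INR; ring).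
assert (hs := step_pos n). rewrite Et. split; nra.
Qed.

Lemma cell_le n t t' : 0 <= t <= t' -> (cell n t <= cell n t')%nat.
Proof.
intros Ht. destruct (cell_bounds n t) as [h1 _]; [lra|].
destruct (cell_bounds n t') as [_ h2]; [lra|].
assert (hs := step_pos n).
assert (INR (cell n t) < INR (S (cell n t'))) by (rewrite S_INR; nra).
apply INR_lt in H. lia.
Qed.

Lemma cell_0 n : cell n 0 = O.
Proof.
destruct (cell_bounds n 0) as [h _]; [lra|]. assert (hs := step_pos n).
destruct (cell n 0) as [|k]; [reflexivity|].
rewrite S_INR in h. generalize (pos_INR k). nra.
Qed.

(** * Increment estimates on the grid and their limits *)

(** Discrete mean value inequality, by telescoping. *)
Lemma drift (x g : nat -> R) (h gam eps : R) (i d : nat) :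
  0 <= h ->
  (forall k, (i <= k < i + d)%nat -> x (S k) = x k + h * g k /\ Rabs (g k - gam) <= eps) ->
  Rabs (x (i + d)%nat - x i - INR d * h * gam) <= INR d * h * eps.
Proof.
intros Hh. induction d as [|d IH]; intros Hx.
- rewrite Nat.add_0_r. simpl INR. replace (_ - _) with 0 by ring. rewrite Rabs_R0. lra.
- assert (IH' := IH ltac:(intros k Hk; apply Hx; lia)).
  destruct (Hx (i + d)%nat ltac:(lia)) as [E1 E2].
  rewrite Nat.add_succ_r, E1, S_INR.
  replace (_ - _) with ((x (i + d)%nat - x i - INR d * h * gam) + h * (g (i + d)%nat - gam)) by ring.
  eapply Rle_trans; [apply Rabs_triang|]. rewrite Rabs_mult, (Rabs_pos_eq h) by exact Hh.
  assert (h * Rabs (g (i + d)%nat - gam) <= h * eps) by (apply Rmult_le_compat_l; assumption).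
  lra.
Qed.

(** The grid steps between the two cells cover a length that differs from t' - t by at most one
    step, so [drift] passes to the limit along U. *)
Lemma drift_limit U (HU : free_ultrafilter U) (x g : nat -> nat -> R) X X' t t' gam eps :
  0 <= t <= t' -> 0 <= eps ->
  ulim U (fun n => x n (cell n t)) X -> ulim U (fun n => x n (cell n t')) X' ->
  U (fun n => forall k, (cell n t <= k < cell n t')%nat ->
       x n (S k) = x n k + step n * g n k /\ Rabs (g n k - gam) <= eps) ->
  Rabs (X' - X - (t' - t) * gam) <= (t' - t) * eps.
Proof.
intros Ht He HX HX' HD. apply Rnot_lt_le. intros Hlt.
set (D := Rabs (X' - X - (t' - t) * gam) - (t' - t) * eps) in *.
assert (HDp : 0 < D) by (unfold D; lra).
(* The two end values and the length of the grid interval are each off by at most eta; together this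
   costs at most eta (2 + |gam| + eps) <= D / 2, less than the supposed excess D. *)
set (eta := D / (4 * (1 + Rabs gam + eps))).
assert (Hg := Rabs_pos gam).
assert (Heta : 0 < eta) by (apply Rdiv_lt_0_compat; lra).
assert (Heta' : eta * (1 + Rabs gam + eps) = D / 4) by (unfold eta; field; lra).
destruct (uf_ex _ HU _ (uf_and _ HU _ _ (HX eta Heta) (uf_and _ HU _ _ (HX' eta Heta)
  (uf_and _ HU _ _ HD (step_small U HU eta Heta))))) as [n [h1 [h2 [h3 h4]]]].
assert (Hc := cell_le n t t' Ht).
destruct (Nat.le_exists_sub _ _ Hc) as [d [Ed _]].
rewrite Ed, Nat.add_comm in h3, h2.
assert (h5 := drift (x n) (g n) (step n) gam eps _ d (Rlt_le _ _ (step_pos n)) h3).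
assert (b1 := cell_bounds n t ltac:(lra)). assert (b2 := cell_bounds n t' ltac:(lra)).
rewrite Ed, plus_INR in b2.
set (T := INR d * step n) in *.
assert (b3 : Rabs (T - (t' - t)) <= eta) by (apply Rabs_le; unfold T; lra).
assert (E : X' - X - (t' - t) * gam =
  (x n (cell n t + d)%nat - x n (cell n t) - T * gam) - (x n (cell n t + d)%nat - X')
  + (x n (cell n t) - X) + (T - (t' - t)) * gam) by ring.
assert (b4 : Rabs (X' - X - (t' - t) * gam) <= T * eps + eta + eta + eta * Rabs gam).
{ rewrite E. eapply Rle_trans; [apply Rabs_triang|].
  rewrite Rabs_mult.
  assert (Rabs (T - (t' - t)) * Rabs gam <= eta * Rabs gam) by (apply Rmult_le_compat_r; lra).
  eapply Rle_trans; [apply Rplus_le_compat_r, Rabs_triang|].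
  eapply Rle_trans; [apply Rplus_le_compat_r, Rplus_le_compat_r, Rabs_triang|].
  rewrite Rabs_Ropp. lra. }
apply Rabs_le_between in b3.
assert (T * eps <= (t' - t) * eps + eta * eps) by nra.
unfold D in *. nra.
Qed.

(** * Euler polygons for V' = W, W' = - k H(t, V) *)

Fixpoint euler (H : R -> R -> R) (k s h : R) (i : nat) : R * R :=
  match i with
  | O => (0, s)
  | S j => let p := euler H k s h j in
           (fst p + h * snd p, snd p - h * (k * H (INR j * h) (fst p)))
  end.

Definition jcont (H : R -> R -> R) : Prop :=
  forall t u eps, 0 < eps -> exists d, 0 < d /\
    forall t' u', Rabs (t' - t) < d -> Rabs (u' - u) < d -> Rabs (H t' u' - H t u) < eps.

(** Bounded on strips unbounded below in u: an Euler polygon is controlled from above by its slope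
    before anything is known of how far it falls. *)
Definition bounded_left (H : R -> R -> R) : Prop :=
  forall S, exists K, forall t u, 0 <= t <= 1 -> u <= S -> H t u <= K.

(** The equation is imposed inside (0, 1) only; continuity on the whole line, harmless after
    clamping, lets the mean value theorem reach the end points. *)
Definition ivp_sol (H : R -> R -> R) (k s : R) (V W : R -> R) : Prop :=
  continuity V /\ continuity W /\ V 0 = 0 /\ W 0 = s /\
  forall t, 0 < t < 1 ->
    derivable_pt_lim V t (W t) /\ derivable_pt_lim W t (- (k * H t (V t))).

Definition clamp (t : R) : R := Rmax 0 (Rmin 1 t).

Lemma clamp_range t : 0 <= clamp t <= 1.
Proof.
unfold clamp. split; [apply Rmax_l|]. apply Rmax_lub; [lra|apply Rmin_l].
Qed.

Lemma clamp_id t : 0 <= t <= 1 -> clamp t = t.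
Proof. intros Ht. unfold clamp. rewrite Rmin_right, Rmax_right; lra. Qed.

Lemma clamp_lip s t : Rabs (clamp s - clamp t) <= Rabs (s - t).
Proof.
assert (Hc : forall x, clamp x = 0 /\ x <= 0 \/ clamp x = x /\ 0 <= x <= 1 \/ clamp x = 1 /\ 1 <= x).
{ intros x. destruct (Rle_or_lt x 0); [|destruct (Rle_or_lt x 1)].
  - left. unfold clamp. rewrite Rmin_right, Rmax_left; lra.
  - right; left. rewrite clamp_id; lra.
  - right; right. unfold clamp. rewrite Rmin_left, Rmax_right; lra. }
unfold Rabs. destruct (Hc s) as [h|[h|h]], (Hc t) as [h'|[h'|h']];
  destruct (Rcase_abs (clamp s - clamp t)), (Rcase_abs (s - t)); lra.
Qed.

(** Bootstrap: the slope only decreases from s, hence the value at time t is at most t s <= S0, and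
    this keeps the next step in the region where k H <= K. *)
Lemma euler_bounds H k s S0 K n :
  (forall t u, 0 <= t <= 1 -> u <= S0 -> 0 <= k * H t u <= K) -> 0 <= s <= S0 ->
  forall i, INR i * step n <= 1 ->
    s - INR i * step n * K <= snd (euler H k s (step n) i) <= s /\
    fst (euler H k s (step n) i) <= INR i * step n * s.
Proof.
intros HK Hs. assert (hs := step_pos n). induction i as [|i IH]; intros Hi.
- simpl. lra.
- rewrite S_INR in Hi. assert (Hi0 := pos_INR i).
  destruct IH as [I1 I2]; [nra|].
  assert (hT : 0 <= INR i * step n <= 1) by nra.
  assert (hf : fst (euler H k s (step n) i) <= S0) by nra.
  assert (HKi := HK (INR i * step n) (fst (euler H k s (step n) i)) hT hf).
  cbn [euler fst snd]. rewrite S_INR. split; nra.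
Qed.

Lemma euler_lip H k s S0 K n :
  (forall t u, 0 <= t <= 1 -> u <= S0 -> 0 <= k * H t u <= K) -> 0 <= s <= S0 ->
  forall i, INR i * step n <= 1 ->
    Rabs (snd (euler H k s (step n) i)) <= S0 + K /\
    Rabs (k * H (INR i * step n) (fst (euler H k s (step n) i))) <= S0 + K.
Proof.
intros HK Hs i Hi. destruct (euler_bounds H k s S0 K n HK Hs i Hi) as [h1 h2].
assert (hs := step_pos n). assert (Hi0 := pos_INR i).
assert (hp := Rmult_le_pos _ _ Hi0 (Rlt_le _ _ hs)).
assert (hf : fst (euler H k s (step n) i) <= S0) by nra.
assert (hK := HK _ _ (conj (Rmult_le_pos _ _ Hi0 (Rlt_le _ _ hs)) Hi) hf).
assert (hK0 : 0 <= K) by lra.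
split; apply Rabs_le; [|lra]. nra.
Qed.

Lemma grid_lip (x g : nat -> R) n C :
  0 <= C ->
  (forall i, INR i * step n <= 1 -> x (S i) = x i + step n * g i /\ Rabs (g i) <= C) ->
  forall i j, INR i * step n <= 1 -> INR j * step n <= 1 ->
  Rabs (x i - x j) <= C * Rabs (INR i * step n - INR j * step n).
Proof.
intros HC Hx.
assert (hs := step_pos n).
assert (Hle : forall i j, (j <= i)%nat -> INR i * step n <= 1 ->
  Rabs (x i - x j) <= C * Rabs (INR i * step n - INR j * step n)).
{ intros i j Hij Hi. destruct (Nat.le_exists_sub _ _ Hij) as [d [-> _]].
  rewrite Nat.add_comm in *.
  assert (h := drift x g (step n) 0 C j d (Rlt_le _ _ hs)).
  rewrite plus_INR in *.
  replace ((INR j + INR d) * step n - INR j * step n) with (INR d * step n) by ring.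
  rewrite (Rabs_pos_eq (INR d * step n)) by (apply Rmult_le_pos; [apply pos_INR|lra]).
  rewrite Rmult_0_r, Rminus_0_r in h. rewrite (Rmult_comm C). apply h.
  intros k Hk. rewrite Rminus_0_r. apply Hx.
  assert (INR k <= INR j + INR d) by (rewrite <- plus_INR; apply le_INR; lia). nra. }
intros i j Hi Hj. destruct (Nat.le_ge_cases j i) as [h|h].
- apply Hle; assumption.
- rewrite Rabs_minus_sym, (Rabs_minus_sym (_ * _)). apply Hle; assumption.
Qed.

(** Equicontinuity: the common Lipschitz constant spreads convergence at the cell of t to all grid
    points near t, with one U-large set of n serving for all of them. *)
Lemma grid_near U (HU : free_ultrafilter U) (x : nat -> nat -> R) C t X :
  0 <= C -> 0 <= t <= 1 ->
  (forall n i j, INR i * step n <= 1 -> INR j * step n <= 1 ->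
    Rabs (x n i - x n j) <= C * Rabs (INR i * step n - INR j * step n)) ->
  ulim U (fun n => x n (cell n t)) X ->
  forall eps, 0 < eps -> exists d, 0 < d /\
    U (fun n => forall k, INR k * step n <= 1 -> Rabs (INR k * step n - t) < d ->
         Rabs (x n k - X) <= eps).
Proof.
intros HC Ht Hlip HX eps Heps.
set (d := eps / (4 * (C + 1))).
assert (Hd : 0 < d) by (apply Rdiv_lt_0_compat; lra).
assert (Hd' : d * (C + 1) = eps / 4) by (unfold d; field; lra).
exists d. split; [exact Hd|].
apply (uf_imp _ HU (fun n => step n < d /\ Rabs (x n (cell n t) - X) < eps / 4)).
2:{ apply uf_and; [exact HU | apply step_small; assumption | apply HX; lra]. }
intros n [h1 h2] k Hk Hkt.
assert (b := cell_bounds n t ltac:(lra)).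
assert (h3 := Hlip n k (cell n t) Hk ltac:(lra)).
assert (h4 : Rabs (INR k * step n - INR (cell n t) * step n) <= 2 * d).
{ apply Rabs_def2 in Hkt. apply Rabs_le. lra. }
replace (x n k - X) with ((x n k - x n (cell n t)) + (x n (cell n t) - X)) by ring.
eapply Rle_trans; [apply Rabs_triang|]. nra.
Qed.

(** Near t0 all difference quotients of the scheme are close to gam, and [drift_limit] transfers
    this to the difference quotients of the limit; no integral equation is involved. *)
Lemma strong_derivative U (HU : free_ultrafilter U) (x g : nat -> nat -> R) (X : R -> R) t0 gam :
  (forall n i, INR i * step n <= 1 -> x n (S i) = x n i + step n * g n i) ->
  (forall t, 0 <= t <= 1 -> ulim U (fun n => x n (cell n t)) (X t)) ->
  (forall eps, 0 < eps -> exists d, 0 < d /\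
    U (fun n => forall k, INR k * step n <= 1 -> Rabs (INR k * step n - t0) < d ->
         Rabs (g n k - gam) <= eps)) ->
  0 < t0 < 1 -> derivable_pt_lim (fun t => X (clamp t)) t0 gam.
Proof.
intros Hrec HX Hg Ht0 eps Heps.
destruct (Hg (eps / 2) ltac:(lra)) as [d [Hd HUd]].
assert (Hst : forall t t', 0 <= t <= t' -> t' <= 1 -> Rabs (t - t0) < d / 2 -> Rabs (t' - t0) < d / 2 ->
  Rabs (X t' - X t - (t' - t) * gam) <= (t' - t) * (eps / 2)).
{ intros t t' Ht Ht1 h1 h2.
  apply (drift_limit U HU x g); [exact Ht | lra | apply HX; lra | apply HX; lra |].
  (* Grid points between the cells of t and t' lie at most one step to the left of t, so with a step
     below d / 2 they stay within d of t0. *)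
  apply (uf_imp _ HU _ _) with (2 := uf_and _ HU _ _ HUd (step_small U HU (d / 2) ltac:(lra))).
  intros n [h3 h4] k Hk.
  assert (b1 := cell_bounds n t ltac:(lra)). assert (b2 := cell_bounds n t' ltac:(lra)).
  assert (hs := step_pos n).
  assert (i1 : INR (cell n t) <= INR k) by (apply le_INR; lia).
  assert (i2 : INR k <= INR (cell n t')) by (apply le_INR; lia).
  assert (j1 : INR (cell n t) * step n <= INR k * step n) by (apply Rmult_le_compat_r; lra).
  assert (j2 : INR k * step n <= INR (cell n t') * step n) by (apply Rmult_le_compat_r; lra).
  apply Rabs_def2 in h1. apply Rabs_def2 in h2.
  split; [apply Hrec; lra|]. apply h3; [lra|]. apply Rabs_def1; lra. }
set (r := Rmin (d / 2) (Rmin t0 (1 - t0))).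
assert (Hr : 0 < r) by (unfold r; repeat apply Rmin_glb_lt; lra).
assert (Hr1 : r <= d / 2) by apply Rmin_l.
assert (Hr2 : r <= t0) by (eapply Rle_trans; [apply Rmin_r|apply Rmin_l]).
assert (Hr3 : r <= 1 - t0) by (eapply Rle_trans; [apply Rmin_r|apply Rmin_r]).
exists (mkposreal r Hr). intros h Hh0 Hh. simpl in Hh.
assert (Hh' := Rabs_def2 _ _ Hh).
rewrite !clamp_id by lra.
assert (Hq : Rabs (X (t0 + h) - X t0 - h * gam) <= Rabs h * (eps / 2)).
{ destruct (Rle_or_lt 0 h) as [p|p].
  - rewrite (Rabs_pos_eq h) by exact p.
    generalize (Hst t0 (t0 + h) ltac:(lra) ltac:(lra)).
    replace (t0 + h - t0) with h by ring. rewrite Rminus_diag, Rabs_R0.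
    intros q. apply q; lra.
  - rewrite (Rabs_left h) by exact p.
    generalize (Hst (t0 + h) t0 ltac:(lra) ltac:(lra)).
    replace (t0 + h - t0) with h by ring. rewrite Rminus_diag, Rabs_R0.
    replace (t0 - (t0 + h)) with (- h) by ring.
    intros q. rewrite Rabs_minus_sym in q.
    replace (- h * gam - (X t0 - X (t0 + h))) with (X (t0 + h) - X t0 - h * gam) in q by ring.
    apply q; lra. }
replace ((X (t0 + h) - X t0) / h - gam) with ((X (t0 + h) - X t0 - h * gam) / h) by (field; exact Hh0).
unfold Rdiv. rewrite Rabs_mult, Rabs_inv.
assert (Hp : 0 < Rabs h) by (apply Rabs_pos_lt, Hh0).
apply Rle_lt_trans with (eps / 2); [|lra].
apply (Rmult_le_reg_l (Rabs h)); [exact Hp|].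
rewrite (Rmult_comm (Rabs (_ - _ - _))), <- Rmult_assoc, Rinv_r by lra. lra.
Qed.

Lemma grid_limit_lip U (HU : free_ultrafilter U) (x g : nat -> nat -> R) (X : R -> R) C :
  0 <= C ->
  (forall n i, INR i * step n <= 1 -> x n (S i) = x n i + step n * g n i /\ Rabs (g n i) <= C) ->
  (forall t, 0 <= t <= 1 -> ulim U (fun n => x n (cell n t)) (X t)) ->
  continuity (fun t => X (clamp t)).
Proof.
intros HC Hx HX.
assert (Hle : forall t t', 0 <= t <= t' -> t' <= 1 -> Rabs (X t' - X t) <= C * (t' - t)).
{ intros t t' Ht Ht1.
  assert (h := drift_limit U HU x g (X t) (X t') t t' 0 C Ht HC (HX t ltac:(lra)) (HX t' ltac:(lra))).
  rewrite Rmult_0_r, Rminus_0_r in h. rewrite Rmult_comm. apply h.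
  apply (uf_imp _ HU (fun n => (0 <= n)%nat)); [|apply uf_tail, HU].
  intros n _ k Hk. rewrite Rminus_0_r. apply Hx.
  assert (b2 := cell_bounds n t' ltac:(lra)). assert (hs := step_pos n).
  assert (i2 : INR k <= INR (cell n t')) by (apply le_INR; lia). nra. }
intros t eps Heps. exists (eps / (C + 1)). split; [apply Rdiv_lt_0_compat; lra|].
intros t' [_ Ht']. simpl in *. unfold Rdist in *.
assert (h1 : Rabs (X (clamp t') - X (clamp t)) <= C * Rabs (clamp t' - clamp t)).
{ assert (c1 := clamp_range t). assert (c2 := clamp_range t').
  destruct (Rle_or_lt (clamp t) (clamp t')) as [p|p].
  - rewrite (Rabs_pos_eq (clamp t' - clamp t)) by lra. apply Hle; lra.
  - rewrite (Rabs_left (clamp t' - clamp t)) by lra. rewrite Rabs_minus_sym, Ropp_minus_distr. apply Hle; lra. }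
assert (h2 := clamp_lip t' t).
assert (h3 := Rabs_pos (t' - t)).
assert (h4 : (C + 1) * Rabs (t' - t) < eps).
{ apply (Rmult_lt_compat_l (C + 1)) in Ht'; [|lra].
  replace ((C + 1) * (eps / (C + 1))) with eps in Ht' by (field; lra). exact Ht'. }
nra.
Qed.

(** Peano existence, with parameters varying along the schemes: the zeros found by shooting move
    with n, and their limit must still give a solution. *)
Lemma euler_peano U (HU : free_ultrafilter U) H (kn sn : nat -> R) k s k0 S0 :
  jcont H -> (forall t u, 0 <= H t u) -> bounded_left H ->
  (forall n, 0 <= kn n <= k0) -> (forall n, 0 <= sn n <= S0) ->
  ulim U kn k -> ulim U sn s ->
  exists V W, ivp_sol H k s V W /\
    forall t, 0 <= t <= 1 ->
      ulim U (fun n => fst (euler H (kn n) (sn n) (step n) (cell n t))) (V t).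
Proof.
intros HC H0 HB Hkn Hsn Hk Hs.
destruct (HB S0) as [K HK].
assert (HK0 : 0 <= K).
{ apply Rle_trans with (H 0 S0); [apply H0|apply HK; lra]. }
assert (Hk0 : 0 <= k0) by (generalize (Hkn O); lra).
assert (HS0 : 0 <= S0) by (generalize (Hsn O); lra).
set (C := S0 + k0 * K).
assert (HCp : 0 <= C) by (unfold C; nra).
assert (HKn : forall n t u, 0 <= t <= 1 -> u <= S0 -> 0 <= kn n * H t u <= k0 * K).
{ intros n t u Ht Hu. generalize (Hkn n) (H0 t u) (HK t u Ht Hu); intros.
  split; [nra|]. apply Rmult_le_compat; lra. }
pose (v := fun n i => fst (euler H (kn n) (sn n) (step n) i)).
pose (w := fun n i => snd (euler H (kn n) (sn n) (step n) i)).
pose (g := fun n i => - (kn n * H (INR i * step n) (v n i))).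
assert (Hv : forall n i, INR i * step n <= 1 -> v n (S i) = v n i + step n * w n i /\ Rabs (w n i) <= C).
{ intros n i Hi. split; [reflexivity|].
  apply (euler_lip H (kn n) (sn n) S0 (k0 * K) n (HKn n) (Hsn n) i Hi). }
assert (Hw : forall n i, INR i * step n <= 1 -> w n (S i) = w n i + step n * g n i /\ Rabs (g n i) <= C).
{ intros n i Hi. split; [unfold g, w, v; simpl; ring|]. unfold g. rewrite Rabs_Ropp.
  apply (euler_lip H (kn n) (sn n) S0 (k0 * K) n (HKn n) (Hsn n) i Hi). }
assert (Hvl := fun n => grid_lip (v n) (w n) n C HCp (Hv n)).
assert (Hwl := fun n => grid_lip (w n) (g n) n C HCp (Hw n)).
(* The range condition stands under the existential, so that choice produces a function on all of R;
   its values off [0, 1] are hidden by [clamp]. *)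
assert (HcellV : forall t, exists l, 0 <= t <= 1 -> ulim U (fun n => v n (cell n t)) l).
{ intros t. destruct (classic (0 <= t <= 1)) as [Ht|Ht].
  2:{ exists 0. intros h; contradiction. }
  destruct (ulim_exists U HU (fun n => v n (cell n t)) C) as [l Hl].
  - intros n. assert (b := cell_bounds n t ltac:(lra)).
    assert (hl := Hvl n (cell n t) O ltac:(lra) ltac:(simpl INR; lra)).
    unfold v at 2 in hl. simpl fst in hl. simpl INR in hl. rewrite Rminus_0_r, Rmult_0_l, Rminus_0_r in hl.
    assert (hp : 0 <= INR (cell n t) * step n) by (apply Rmult_le_pos; [apply pos_INR|apply Rlt_le, step_pos]).
    rewrite (Rabs_pos_eq (INR _ * _)) in hl by exact hp. nra.
  - exists l. intros _; exact Hl. }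
assert (HcellW : forall t, exists l, 0 <= t <= 1 -> ulim U (fun n => w n (cell n t)) l).
{ intros t. destruct (classic (0 <= t <= 1)) as [Ht|Ht].
  2:{ exists 0. intros h; contradiction. }
  destruct (ulim_exists U HU (fun n => w n (cell n t)) C) as [l Hl].
  - intros n. assert (b := cell_bounds n t ltac:(lra)). apply (Hv n (cell n t)). lra.
  - exists l. intros _; exact Hl. }
pose (V := fun t => proj1_sig (constructive_indefinite_description _ (HcellV t))).
pose (W := fun t => proj1_sig (constructive_indefinite_description _ (HcellW t))).
assert (HV : forall t, 0 <= t <= 1 -> ulim U (fun n => v n (cell n t)) (V t)).
{ intros t. exact (proj2_sig (constructive_indefinite_description _ (HcellV t))). }
assert (HW : forall t, 0 <= t <= 1 -> ulim U (fun n => w n (cell n t)) (W t)).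
{ intros t. exact (proj2_sig (constructive_indefinite_description _ (HcellW t))). }
exists (fun t => V (clamp t)), (fun t => W (clamp t)). split; [split; [|split; [|split; [|split]]]|].
- exact (grid_limit_lip U HU v w V C HCp Hv HV).
- exact (grid_limit_lip U HU w g W C HCp Hw HW).
- cbv beta. rewrite clamp_id by lra.
  apply (ulim_ext U HU (fun n => v n (cell n 0)) (fun _ => 0));
    [intros n; rewrite cell_0; reflexivity | apply HV; lra | apply ulim_const, HU].
- cbv beta. rewrite clamp_id by lra.
  apply (ulim_ext U HU (fun n => w n (cell n 0)) sn);
    [intros n; rewrite cell_0; reflexivity | apply HW; lra | exact Hs].
- intros t Ht. cbv beta. rewrite (clamp_id t) by lra. split.
  + apply (strong_derivative U HU v w V); [intros; apply Hv; assumption|exact HV| |exact Ht].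
    exact (grid_near U HU w C t (W t) HCp ltac:(lra) Hwl (HW t ltac:(lra))).
  + apply (strong_derivative U HU w g W); [intros; apply Hw; assumption|exact HW| |exact Ht].
    intros eps Heps.
    (* With A = H(t, V t), the error splits as kn (H - A) + (kn - k) A; [e1] keeps the first term
       below eps / 2 through kn <= k0, and [e2] the second. *)
    set (e1 := eps / (2 * (k0 + 1))).
    assert (He1 : 0 < e1) by (apply Rdiv_lt_0_compat; lra).
    assert (He1' : e1 * (k0 + 1) = eps / 2) by (unfold e1; field; lra).
    set (A := H t (V t)). assert (HA : 0 <= A) by apply H0.
    set (e2 := eps / (2 * (A + 1))).
    assert (He2 : 0 < e2) by (apply Rdiv_lt_0_compat; lra).
    assert (He2' : e2 * (A + 1) = eps / 2) by (unfold e2; field; lra).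
    destruct (HC t (V t) e1 He1) as [dH [HdH HcH]].
    destruct (grid_near U HU v C t (V t) HCp ltac:(lra) Hvl (HV t ltac:(lra)) (dH / 2) ltac:(lra))
      as [d [Hd HUd]].
    exists (Rmin d dH). split; [apply Rmin_glb_lt; assumption|].
    apply (uf_imp _ HU _ _) with (2 := uf_and _ HU _ _ HUd (Hk e2 He2)).
    intros n [h1 h2] i Hi Hit.
    assert (h3 := h1 i Hi (Rlt_le_trans _ _ _ Hit (Rmin_l _ _))).
    assert (h4 := HcH (INR i * step n) (v n i) (Rlt_le_trans _ _ _ Hit (Rmin_r _ _)) ltac:(lra)).
    unfold g. fold A in h4 |- *.
    replace (- (kn n * H (INR i * step n) (v n i)) - - (k * A)) with
      (- (kn n * (H (INR i * step n) (v n i) - A) + (kn n - k) * A)) by ring.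
    rewrite Rabs_Ropp. eapply Rle_trans; [apply Rabs_triang|].
    rewrite !Rabs_mult, (Rabs_pos_eq A) by exact HA.
    rewrite (Rabs_pos_eq (kn n)) by apply Hkn.
    assert (p1 := Rabs_pos (H (INR i * step n) (v n i) - A)).
    assert (p2 := Rabs_pos (kn n - k)). assert (p3 := Hkn n).
    assert (kn n * Rabs (H (INR i * step n) (v n i) - A) <= k0 * e1) by (apply Rmult_le_compat; lra).
    nra.
- intros t Ht. cbv beta. rewrite clamp_id by exact Ht. exact (HV t Ht).
Qed.

(** * Shooting through the Euler schemes *)

Lemma jcont_section H t : jcont H -> continuity (H t).
Proof.
intros HC u eps Heps. destruct (HC t u eps Heps) as [d [Hd h]].
exists d. split; [exact Hd|]. intros u' [_ Hu']. apply h; [|exact Hu'].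
rewrite Rminus_diag, Rabs_R0. exact Hd.
Qed.

Lemma euler_continuous H (kf sf : R -> R) h i :
  jcont H -> continuity kf -> continuity sf ->
  continuity (fun p => fst (euler H (kf p) (sf p) h i)) /\
  continuity (fun p => snd (euler H (kf p) (sf p) h i)).
Proof.
intros HC Hk Hs. induction i as [|i [IH1 IH2]].
- split; [apply continuity_const; intros x y; reflexivity | exact Hs].
- split.
  + apply (continuity_plus _ (fun p => h * snd (euler H (kf p) (sf p) h i))); [exact IH1|].
    apply (continuity_scal (fun p => snd (euler H (kf p) (sf p) h i))). exact IH2.
  + apply (continuity_minus _ (fun p => h * (kf p * H (INR i * h) (fst (euler H (kf p) (sf p) h i))))); [exact IH2|].
    apply (continuity_scal (fun p => kf p * H (INR i * h) (fst (euler H (kf p) (sf p) h i)))).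
    apply (continuity_mult kf (fun p => H (INR i * h) (fst (euler H (kf p) (sf p) h i)))); [exact Hk|].
    apply (continuity_comp (fun p => fst (euler H (kf p) (sf p) h i)) (H (INR i * h))); [exact IH1|].
    apply jcont_section, HC.
Qed.

(* Solutions of the initial value problem need not be unique, so the
   intermediate value theorem is applied to the Euler schemes and the zeros
   are passed to the limit. *)
Lemma shooting H (kf sf : R -> R) P0 P1 k0 S0 :
  jcont H -> (forall t u, 0 <= H t u) -> bounded_left H ->
  continuity kf -> continuity sf -> P0 <= P1 ->
  (forall p, P0 <= p <= P1 -> 0 <= kf p <= k0 /\ 0 <= sf p <= S0) ->
  (forall V W, ivp_sol H (kf P0) (sf P0) V W -> 0 < V 1) ->
  (forall V W, ivp_sol H (kf P1) (sf P1) V W -> V 1 < 0) ->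
  exists p V W, P0 <= p <= P1 /\ ivp_sol H (kf p) (sf p) V W /\ V 1 = 0.
Proof.
intros HC H0 HB Hkc Hsc HP Hks Hpos Hneg.
destruct free_ultrafilter_exists as [U HU].
pose (e := fun n p => fst (euler H (kf p) (sf p) (step n) (cell n 1))).
assert (Pc : forall p, P0 <= p <= P1 -> exists V W, ivp_sol H (kf p) (sf p) V W /\
    ulim U (fun n => e n p) (V 1)).
{ intros p Hp.
  destruct (euler_peano U HU H (fun _ => kf p) (fun _ => sf p) (kf p) (sf p) k0 S0 HC H0 HB)
    as [V [W [h1 h2]]]; try (intros; apply Hks; assumption); try apply ulim_const, HU.
  exists V, W. split; [exact h1|]. apply h2. lra. }
(* The end conditions speak of all solutions, hence of the one which the schemes select; its strict
   sign at 1 passes back to U-almost all schemes. *)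
assert (HU0 : U (fun n => 0 < e n P0)).
{ destruct (Pc P0 ltac:(lra)) as [V [W [h1 h2]]]. assert (h3 := Hpos V W h1).
  apply (uf_imp _ HU _ _) with (2 := h2 _ h3). intros n h. apply Rabs_def2 in h. lra. }
assert (HU1 : U (fun n => e n P1 < 0)).
{ destruct (Pc P1 ltac:(lra)) as [V [W [h1 h2]]]. assert (h3 := Hneg V W h1).
  apply (uf_imp _ HU _ _) with (2 := h2 (- V 1) ltac:(lra)). intros n h. apply Rabs_def2 in h. lra. }
(* A sign change is known for U-almost all n only; the remaining indices receive the default
   [P0]. *)
assert (Hz : forall n, exists p, P0 <= p <= P1 /\ (0 < e n P0 -> e n P1 < 0 -> e n p = 0)).
{ intros n. destruct (classic (0 < e n P0 /\ e n P1 < 0)) as [[h1 h2]|h].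
  - destruct (IVT_cor (e n) P0 P1) as [p [hp he]]; [|exact HP|nra|].
    + apply euler_continuous; assumption.
    + exists p. split; [exact hp|]. intros _ _; exact he.
  - exists P0. split; [lra|]. intros h1 h2. exfalso; apply h; split; assumption. }
pose (pn := fun n => proj1_sig (constructive_indefinite_description _ (Hz n))).
assert (Hpn : forall n, P0 <= pn n <= P1 /\ (0 < e n P0 -> e n P1 < 0 -> e n (pn n) = 0)).
{ intros n. exact (proj2_sig (constructive_indefinite_description _ (Hz n))). }
destruct (ulim_exists U HU pn (Rabs P0 + Rabs P1)) as [p Hp].
{ intros n. generalize (proj1 (Hpn n)). intros h. apply Rabs_le.
  generalize (Rle_abs P0) (Rle_abs P1) (Rle_abs (- P0)) (Rle_abs (- P1)).
  rewrite !Rabs_Ropp. lra. }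
assert (HpP : P0 <= p <= P1).
{ assert (T : forall A : nat -> Prop, (forall n, A n) -> U A).
  { intros A HA. apply (uf_imp _ HU (fun n => (0 <= n)%nat)); [intros; apply HA|apply uf_tail, HU]. }
  split.
  - apply (ulim_le U HU (fun _ => P0) pn); [apply T; intros; apply Hpn|apply ulim_const, HU|exact Hp].
  - apply (ulim_le U HU pn (fun _ => P1)); [apply T; intros; apply Hpn|exact Hp|apply ulim_const, HU]. }
destruct (euler_peano U HU H (fun n => kf (pn n)) (fun n => sf (pn n)) (kf p) (sf p) k0 S0 HC H0 HB)
  as [V [W [h1 h2]]].
- intros n. apply Hks, Hpn.
- intros n. apply Hks, Hpn.
- apply ulim_continuous; [exact HU|apply Hkc|exact Hp].
- apply ulim_continuous; [exact HU|apply Hsc|exact Hp].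
- exists p, V, W. split; [exact HpP|]. split; [exact h1|].
  assert (h3 := h2 1 ltac:(lra)).
  assert (E : U (fun n => e n (pn n) = 0)).
  { apply (uf_imp _ HU _ _) with (2 := uf_and _ HU _ _ HU0 HU1). intros n [a b]. apply Hpn; assumption. }
  apply Rle_antisym.
  + apply (ulim_le U HU (fun n => e n (pn n)) (fun _ => 0)); [|exact h3|apply ulim_const, HU].
    apply (uf_imp _ HU _ _) with (2 := E). intros; lra.
  + apply (ulim_le U HU (fun _ => 0) (fun n => e n (pn n))); [|apply ulim_const, HU|exact h3].
    apply (uf_imp _ HU _ _) with (2 := E). intros; lra.
Qed.

(** * Comparison for solutions of the initial value problem *)

Lemma continuity_pt_eps f x : continuity_pt f x ->
  forall e, 0 < e -> exists d, 0 < d /\ forall y, Rabs (y - x) < d -> Rabs (f y - f x) < e.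
Proof.
intros Hf e He. destruct (Hf e He) as [d [Hd h]]. exists d. split; [exact Hd|].
intros y Hy. destruct (Req_dec x y) as [<-|Hne].
- rewrite Rminus_diag, Rabs_R0. exact He.
- apply h. split; [split; [exact I|exact Hne]|exact Hy].
Qed.

Lemma continuity_pt_of_eps f x :
  (forall e, 0 < e -> exists d, 0 < d /\ forall y, Rabs (y - x) < d -> Rabs (f y - f x) < e) ->
  continuity_pt f x.
Proof.
intros Hf e He. destruct (Hf e He) as [d [Hd h]]. exists d. split; [exact Hd|].
intros y [_ Hy]. apply h, Hy.
Qed.

Lemma mvt_open f f' a b : a < b ->
  (forall x, a <= x <= b -> continuity_pt f x) ->
  (forall x, a < x < b -> derivable_pt_lim f x (f' x)) ->
  exists c, a < c < b /\ f b - f a = f' c * (b - a).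
Proof.
intros Hab Hc Hd.
destruct (MVT f id a b (fun c P => exist _ (f' c) (Hd c P)) (fun c _ => derivable_pt_id c) Hab Hc)
  as [c [P E]].
- intros c _. apply derivable_continuous_pt, derivable_pt_id.
- exists c. split; [exact P|].
  rewrite (derive_pt_eq_0 _ _ 1 (derivable_pt_id c) (derivable_pt_lim_id c)) in E.
  unfold id in E. simpl in E. lra.
Qed.

Lemma jcont_mult A B : jcont A -> jcont B -> jcont (fun t u => A t u * B t u).
Proof.
intros HA HB t u eps Heps.
assert (pa := Rabs_pos (A t u)). assert (pb := Rabs_pos (B t u)).
set (e := Rmin 1 (eps / (2 * (1 + Rabs (A t u) + Rabs (B t u))))).
assert (He : 0 < e).
{ apply Rmin_glb_lt; [lra|]. apply Rdiv_lt_0_compat; lra. }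
assert (He1 : e <= 1) by apply Rmin_l.
assert (He2 : e * (1 + Rabs (A t u) + Rabs (B t u)) <= eps / 2).
{ apply Rle_trans with (eps / (2 * (1 + Rabs (A t u) + Rabs (B t u))) * (1 + Rabs (A t u) + Rabs (B t u))).
  - apply Rmult_le_compat_r; [lra|apply Rmin_r].
  - right. field. lra. }
destruct (HA t u e He) as [d1 [Hd1 h1]]. destruct (HB t u e He) as [d2 [Hd2 h2]].
exists (Rmin d1 d2). split; [apply Rmin_glb_lt; assumption|].
intros t' u' Ht Hu.
assert (k1 := h1 t' u' (Rlt_le_trans _ _ _ Ht (Rmin_l _ _)) (Rlt_le_trans _ _ _ Hu (Rmin_l _ _))).
assert (k2 := h2 t' u' (Rlt_le_trans _ _ _ Ht (Rmin_r _ _)) (Rlt_le_trans _ _ _ Hu (Rmin_r _ _))).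
set (da := A t' u' - A t u) in *. set (db := B t' u' - B t u) in *.
replace (A t' u' * B t' u' - A t u * B t u) with (da * db + da * B t u + A t u * db)
  by (unfold da, db; ring).
eapply Rle_lt_trans; [eapply Rle_trans; [apply Rabs_triang|apply Rplus_le_compat_r, Rabs_triang]|].
rewrite !Rabs_mult.
assert (qa := Rabs_pos da). assert (qb := Rabs_pos db).
assert (Rabs da * Rabs db <= e * 1) by (apply Rmult_le_compat; lra).
assert (Rabs da * Rabs (B t u) <= e * Rabs (B t u)) by (apply Rmult_le_compat_r; lra).
assert (Rabs (A t u) * Rabs db <= Rabs (A t u) * e) by (apply Rmult_le_compat_l; lra).
lra.
Qed.

Lemma jcont_fst f : continuity f -> jcont (fun t _ => f t).
Proof.
intros Hf t u e He. destruct (continuity_pt_eps f t (Hf t) e He) as [d [Hd h]].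
exists d. split; [exact Hd|]. intros t' u' Ht _. apply h, Ht.
Qed.

Lemma Rmax_0_lip u u' : Rabs (Rmax 0 u' - Rmax 0 u) <= Rabs (u' - u).
Proof.
unfold Rmax. destruct (Rle_dec 0 u'), (Rle_dec 0 u); unfold Rabs;
  repeat destruct Rcase_abs; lra.
Qed.

Lemma jcont_diagonal H V : jcont H -> continuity V -> continuity (fun t => H t (V t)).
Proof.
intros HH HV t. apply continuity_pt_of_eps. intros e He.
destruct (HH t (V t) e He) as [d [Hd h]].
destruct (continuity_pt_eps V t (HV t) d Hd) as [d' [Hd' h']].
exists (Rmin d d'). split; [apply Rmin_glb_lt; assumption|].
intros y Hy. apply h; [|apply h'].
- exact (Rlt_le_trans _ _ _ Hy (Rmin_l _ _)).
- exact (Rlt_le_trans _ _ _ Hy (Rmin_r _ _)).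
Qed.

Lemma continuity_bounded f : continuity f -> exists K, 0 <= K /\ forall t, 0 <= t <= 1 -> Rabs (f t) <= K.
Proof.
intros Hf.
destruct (continuity_ab_maj (fun t => Rabs (f t)) 0 1) as [M [HM _]]; [lra| |].
- intros c _. apply (continuity_pt_comp f Rabs); [apply Hf|apply Rcontinuity_abs].
- exists (Rabs (f M)). split; [apply Rabs_pos|exact HM].
Qed.

(** * Concavity of solutions with nonnegative right-hand side *)

Section Concavity.

Context {H : R -> R -> R} {k s : R} {V W : R -> R}.
Context (H0 : forall t u, 0 <= H t u) (k0 : 0 <= k) (sol : ivp_sol H k s V W).

Lemma slope_le a b : 0 <= a <= b -> b <= 1 -> W b <= W a.
Proof.
destruct sol as [cV [cW [_ [_ D]]]]. intros Hab Hb.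
destruct (Req_dec a b) as [<-|Hne]; [lra|].
destruct (mvt_open W (fun t => - (k * H t (V t))) a b) as [c [Hc E]];
  [lra | intros; apply cW | intros x Hx; apply D; lra |].
assert (h := Rmult_le_pos _ _ (Rmult_le_pos _ _ k0 (H0 c (V c))) (Rge_le _ _ (Rge_minus b a ltac:(lra)))). lra.
Qed.

Lemma tangent_bounds a b : 0 <= a <= b -> b <= 1 -> W b * (b - a) <= V b - V a <= W a * (b - a).
Proof.
intros Hab Hb. assert (sl := slope_le).
destruct sol as [cV [cW [_ [_ D]]]].
destruct (Req_dec a b) as [<-|Hne]; [lra|].
destruct (mvt_open V W a b) as [c [Hc E]];
  [lra | intros; apply cV | intros x Hx; apply D; lra |].
rewrite E. assert (h1 := sl a c ltac:(lra) ltac:(lra)). assert (h2 := sl c b ltac:(lra) ltac:(lra)).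
split; apply Rmult_le_compat_r; lra.
Qed.

Lemma chord_le a t b : 0 <= a <= t -> t <= b <= 1 ->
  (b - t) * V a + (t - a) * V b <= (b - a) * V t.
Proof.
intros h1 h2. assert (p := tangent_bounds a t h1 ltac:(lra)).
assert (q := tangent_bounds t b ltac:(lra) ltac:(lra)). nra.
Qed.

Lemma sol_init : V 0 = 0 /\ W 0 = s.
Proof. destruct sol as [_ [_ [h1 [h2 _]]]]. split; assumption. Qed.

Lemma pos_near_0 : 0 < s -> forall e, 0 < e -> exists x, 0 < x < e /\ x < 1 /\ 0 < V x.
Proof.
intros Hs e He. destruct sol_init as [V0 W0].
destruct sol as [_ [cW _]].
destruct (continuity_pt_eps W 0 (cW 0) s Hs) as [d [Hd h]].
exists (Rmin d (Rmin e 1) / 2).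
assert (p : 0 < Rmin d (Rmin e 1)) by (repeat apply Rmin_glb_lt; lra).
assert (p1 : Rmin d (Rmin e 1) <= d) by apply Rmin_l.
assert (p2 : Rmin d (Rmin e 1) <= e) by (eapply Rle_trans; [apply Rmin_r|apply Rmin_l]).
assert (p3 : Rmin d (Rmin e 1) <= 1) by (eapply Rle_trans; [apply Rmin_r|apply Rmin_r]).
set (x := Rmin d (Rmin e 1) / 2) in *.
assert (hx : 0 < x /\ x < d /\ x < e /\ x < 1) by (unfold x; lra).
split; [lra|]. split; [lra|].
assert (hW := h x ltac:(rewrite Rminus_0_r, Rabs_pos_eq; lra)).
apply Rabs_def2 in hW.
assert (t := tangent_bounds 0 x ltac:(lra) ltac:(lra)). nra.
Qed.

(** The graph lies above the chord that joins a point near 0, where the initial slope makes V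
    positive, to the end value V(1) >= 0. *)
Lemma pos_inside : 0 < s -> 0 <= V 1 -> forall t, 0 < t < 1 -> 0 < V t.
Proof.
intros Hs H1 t Ht. destruct (pos_near_0 Hs t ltac:(lra)) as [x [hx [hx1 hV]]].
assert (c := chord_le x t 1 ltac:(lra) ltac:(lra)). nra.
Qed.

End Concavity.

(** * The linear equation below its first eigenvalue *)

(** Truncated at 0, the linear right-hand side becomes nonnegative and satisfies [bounded_left], so
    that [shooting] applies to it; positive solutions do not see the truncation. *)
Definition linear_rhs (m : R -> R) (t u : R) : R := m t * Rmax 0 u.

Lemma linear_rhs_jcont m : continuity m -> jcont (linear_rhs m).
Proof.
intros Hm. apply (jcont_mult (fun t _ => m t) (fun _ u => Rmax 0 u)); [apply jcont_fst, Hm|].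
intros t u e He. exists e. split; [exact He|]. intros t' u' _ Hu.
eapply Rle_lt_trans; [apply Rmax_0_lip|exact Hu].
Qed.

Lemma linear_rhs_bounded m : continuity m -> (forall t, 0 <= m t) -> bounded_left (linear_rhs m).
Proof.
intros Hm Hm0 S. destruct (continuity_bounded m Hm) as [K [HK0 HK]].
exists (K * Rmax 0 S). intros t u Ht Hu. unfold linear_rhs.
apply Rmult_le_compat; [apply Hm0|apply Rmax_l| |].
- eapply Rle_trans; [apply Rle_abs|apply HK, Ht].
- apply Rle_max_compat_l, Hu.
Qed.

Lemma linear_rhs_nonneg m : (forall t, 0 <= m t) -> forall t u, 0 <= linear_rhs m t u.
Proof. intros Hm t u. apply Rmult_le_pos; [apply Hm|apply Rmax_l]. Qed.

Lemma ivp_C2 H k s V W : jcont H -> ivp_sol H k s V W ->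
  cont_on_closed 0 1 V /\ C2_open01 V (fun t => - (k * H t (V t))).
Proof.
intros HH [cV [cW [_ [_ D]]]]. split.
- intros t _ e He. destruct (continuity_pt_eps V t (cV t) e He) as [d [Hd h]].
  exists d. split; [exact Hd|]. intros x _ Hx. apply h, Hx.
- exists W. intros t Ht. destruct (D t Ht) as [D1 D2].
  split; [apply is_derive_Reals, D1|]. split; [apply is_derive_Reals, D2|].
  apply continuity_pt_filterlim.
  apply (continuity_opp (fun t => k * H t (V t))).
  apply (continuity_scal (fun t => H t (V t))). apply jcont_diagonal; assumption.
Qed.

Lemma linear_eigenvalue m mu V W :
  continuity m -> (forall t, 0 <= m t) -> 0 <= mu ->
  ivp_sol (linear_rhs m) mu 1 V W -> V 1 = 0 -> is_eigenvalue m mu.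
Proof.
intros Hm Hm0 Hmu sol H1.
assert (P := pos_inside (linear_rhs_nonneg m Hm0) Hmu sol Rlt_0_1 (Req_le_sym _ _ H1)).
destruct (ivp_C2 _ _ _ _ _ (linear_rhs_jcont m Hm) sol) as [c1 c2].
exists V, (fun t => - (mu * linear_rhs m t (V t))).
split; [exact c1|]. split; [exact c2|]. split; [|split; [|split; [exact H1|]]].
- intros t Ht. unfold linear_rhs. rewrite Rmax_right by (apply Rlt_le, P, Ht). ring.
- exact (proj1 (sol_init sol)).
- exists (1/2). split; [lra|]. apply Rgt_not_eq, P. lra.
Qed.

(** Otherwise every solution at parameter alpha is negative at 1 (a zero there would make alpha an
    eigenvalue), while at parameter 0 the solution is t; shooting between the two yields an
    eigenvalue in [0, alpha], below [lam1]. *)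
Lemma positive_subcritical_solution m lam1 alpha :
  continuity m -> (forall t, 0 <= m t) -> is_first_eigenvalue m lam1 ->
  0 <= alpha < lam1 ->
  exists V W, ivp_sol (linear_rhs m) alpha 1 V W /\ 0 < V 1.
Proof.
intros Hm Hm0 [_ Hmin] Ha. apply NNPP. intros Hno.
destruct (shooting (linear_rhs m) id (fun _ => 1) 0 alpha alpha 1) as [mu [V [W [Hmu [sol H1]]]]].
- apply linear_rhs_jcont, Hm.
- apply linear_rhs_nonneg, Hm0.
- apply linear_rhs_bounded; assumption.
- apply derivable_continuous, derivable_id.
- apply continuity_const. intros x y; reflexivity.
- lra.
- intros p Hp. unfold id. lra.
- intros V W sol. destruct (sol_init sol) as [V0 W0].
  (* At parameter 0 the slope keeps its initial value 1, and W 1 <= V 1. *)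
  assert (b := tangent_bounds (linear_rhs_nonneg m Hm0) (Rle_refl 0) sol 0 1 ltac:(lra) ltac:(lra)).
  destruct sol as [_ [cW [_ [_ D]]]].
  destruct (mvt_open W (fun t => - (id 0 * linear_rhs m t (V t))) 0 1) as [c [Hc E]];
    [lra | intros; apply cW | intros x Hx; apply D; lra |].
  unfold id in E. lra.
- unfold id. intros V W sol. apply Rnot_le_lt. intros Hge.
  destruct (Req_dec (V 1) 0) as [E|E].
  + assert (h := Hmin alpha (linear_eigenvalue m alpha V W Hm Hm0 (proj1 Ha) sol E)). lra.
  + apply Hno. exists V, W. split; [exact sol|]. lra.
- assert (h := Hmin mu (linear_eigenvalue m mu V W Hm Hm0 (proj1 Hmu) sol H1)). lra.
Qed.

(** * Wronskian comparison *)

Lemma derivable_pt_lim_wronskian V W y z x a b :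
  derivable_pt_lim V x (W x) -> derivable_pt_lim W x a ->
  derivable_pt_lim y x (z x) -> derivable_pt_lim z x b ->
  derivable_pt_lim (fun t => W t * y t - V t * z t) x (a * y x - V x * b).
Proof.
intros h1 h2 h3 h4.
replace (a * y x - V x * b) with ((a * y x + W x * z x) - (W x * z x + V x * b)) by ring.
exact (derivable_pt_lim_minus _ _ _ _ _ (derivable_pt_lim_mult _ _ _ _ _ h2 h3)
  (derivable_pt_lim_mult _ _ _ _ _ h1 h4)).
Qed.

(* Sturm comparison with a solution [y] of the linear equation that is positive on (0, 1]. *)
Lemma small_slope_positive H m alpha lam1 delta s V W :
  (forall t u, 0 <= H t u) -> (forall t u, u <= 0 -> H t u = 0) ->
  continuity m -> (forall t, 0 <= m t) -> is_first_eigenvalue m lam1 ->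
  0 <= alpha < lam1 ->
  (forall t u, 0 < t < 1 -> 0 < u < delta -> H t u <= alpha * m t * u) ->
  0 < s < delta -> ivp_sol H 1 s V W -> 0 < V 1.
Proof.
intros H0 Hneg Hm Hm0 Hfirst Ha Hsmall Hs sol. apply Rnot_le_lt. intros HV1.
destruct (positive_subcritical_solution m lam1 alpha Hm Hm0 Hfirst Ha) as [y [z [soly Hy1]]].
assert (Hy := pos_inside (linear_rhs_nonneg m Hm0) (proj1 Ha) soly Rlt_0_1 (Rlt_le _ _ Hy1)).
destruct (pos_near_0 H0 Rle_0_1 sol (proj1 Hs) 1 Rlt_0_1) as [x0 [Hx0 [_ HVx0]]].
assert (tb := tangent_bounds H0 Rle_0_1 sol). assert (ch := chord_le H0 Rle_0_1 sol).
destruct (sol_init sol) as [V0 W0]. destruct (sol_init soly) as [y0 z0].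
destruct sol as [cV [cW [_ [_ D]]]]. destruct soly as [cy [cz [_ [_ Dy]]]].
destruct (IVT_cor V x0 1 cV ltac:(lra) ltac:(nra)) as [T [HT HVT]].
assert (HT0 : x0 < T).
{ destruct (Req_dec x0 T) as [e|e]; [rewrite <- e in HVT; lra|lra]. }
assert (HyT : 0 < y T).
{ destruct (Req_dec T 1) as [->|e]; [exact Hy1|apply Hy; lra]. }
destruct (mvt_open (fun t => W t * y t - V t * z t)
  (fun t => - (1 * H t (V t)) * y t - V t * - (alpha * linear_rhs m t (y t))) 0 T) as [c [Hc E]].
- lra.
- intros x _. apply (continuity_minus (fun t => W t * y t) (fun t => V t * z t));
    apply continuity_mult; assumption.
- intros x Hx. destruct (D x ltac:(lra)) as [D1 D2]. destruct (Dy x ltac:(lra)) as [D3 D4].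
  apply derivable_pt_lim_wronskian; assumption.
- assert (Hyc := Hy c ltac:(lra)).
  assert (HVc : 0 <= V c).
  { assert (q := ch 0 c T ltac:(lra) ltac:(lra)). nra. }
  (* By concavity V c <= s c with s < delta: the solution never leaves the range of the growth
     condition near 0. *)
  assert (HVs : V c < delta).
  { assert (q := tb 0 c ltac:(lra) ltac:(lra)). nra. }
  assert (HHc : H c (V c) <= alpha * m c * V c).
  { destruct (Req_dec (V c) 0) as [e|e].
    - rewrite e, (Hneg c 0 (Rle_refl 0)). lra.
    - apply Hsmall; lra. }
  unfold linear_rhs in E. rewrite (Rmax_right 0 (y c)) in E by lra.
  rewrite HVT, V0, y0 in E.
  (* The Wronskian W y - V z vanishes at 0, is nondecreasing on average up to T, and equals W T * y
     T there. The resulting sign of W T contradicts concavity, since V falls from V x0 > 0 to V T =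
     0. *)
  assert (HWT : 0 <= W T).
  { assert (0 <= W T * y T); [|nra].
    replace (W T * y T) with (W T * y T - 0 * z T - (W 0 * 0 - 0 * z 0)) by ring.
    rewrite E. apply Rmult_le_pos; [|lra].
    replace (- (1 * H c (V c)) * y c - V c * - (alpha * (m c * y c)))
      with ((alpha * m c * V c - H c (V c)) * y c) by ring.
    apply Rmult_le_pos; lra. }
  assert (q := tb x0 T ltac:(lra) ltac:(lra)). nra.
Qed.

Lemma last_zero f t : continuity f -> 0 < t -> f 0 = 0 -> 0 < f t ->
  exists a, 0 <= a < t /\ f a = 0 /\ forall x, a < x <= t -> 0 < f x.
Proof.
intros cf Ht f0 ft.
destruct (completeness (fun x => 0 <= x <= t /\ f x <= 0)) as [a [ub lub]].
- exists t. intros x [hx _]. lra.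
- exists 0. lra.
- assert (a0 : 0 <= a) by (apply ub; lra).
  assert (at_ : a <= t) by (apply lub; intros x [hx _]; lra).
  assert (fpos : forall x, a < x <= t -> 0 < f x).
  { intros x hx. apply Rnot_le_lt. intros h. assert (x <= a) by (apply ub; lra). lra. }
  assert (fa : f a <= 0).
  { apply Rnot_lt_le. intros h.
    destruct (continuity_pt_eps f a (cf a) (f a) h) as [d [Hd hd]].
    assert (a <= a - d); [|lra]. apply lub. intros x [hx hfx].
    apply Rnot_lt_le. intros hxa.
    assert (x <= a) by (apply ub; split; assumption).
    assert (q := hd x ltac:(apply Rabs_def1; lra)). apply Rabs_def2 in q. lra. }
  assert (at' : a < t) by (destruct (Req_dec a t) as [e|e]; [rewrite e in fa; lra|lra]).
  exists a. split; [lra|]. split; [|exact fpos].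
  apply Rle_antisym; [exact fa|]. apply Rnot_lt_le. intros h.
  destruct (continuity_pt_eps f a (cf a) (- f a) ltac:(lra)) as [d [Hd hd]].
  set (r := Rmin (d / 2) (t - a)).
  assert (r0 : 0 < r) by (apply Rmin_glb_lt; lra).
  assert (r1 : r <= d / 2) by apply Rmin_l. assert (r2 : r <= t - a) by apply Rmin_r.
  assert (q := hd (a + r) ltac:(apply Rabs_def1; lra)). apply Rabs_def2 in q.
  assert (p := fpos (a + r) ltac:(lra)). lra.
Qed.

(** A component of the positivity set, from [last_zero] for f and for its reflection. Working there
    avoids proving that a first eigenfunction has no interior zero. *)
Lemma nodal_interval f t : continuity f -> 0 < t < 1 -> f 0 = 0 -> f 1 = 0 -> 0 < f t ->
  exists a b, 0 <= a < t /\ t < b <= 1 /\ f a = 0 /\ f b = 0 /\ forall x, a < x < b -> 0 < f x.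
Proof.
intros cf Ht f0 f1 ft.
destruct (last_zero f t cf (proj1 Ht) f0 ft) as [a [ha [fa pa]]].
destruct (last_zero (fun x => f (1 - x)) (1 - t)) as [b [hb [fb pb]]].
- apply (continuity_comp (fun x => 1 - x) f); [|exact cf].
  apply (continuity_minus (fun _ => 1) id);
    [apply continuity_const; intros x y; reflexivity | apply derivable_continuous, derivable_id].
- lra.
- rewrite Rminus_0_r. exact f1.
- replace (1 - (1 - t)) with t by ring. exact ft.
- exists a, (1 - b). repeat split; try lra; try assumption.
  intros x hx. destruct (Rle_or_lt x t) as [h|h]; [apply pa; lra|].
  replace x with (1 - (1 - x)) by ring. apply pb. lra.
Qed.

Lemma clamp_continuous u : cont_on_closed 0 1 u -> continuity (fun t => u (clamp t)).
Proof.
intros Hu t. apply continuity_pt_of_eps. intros e He.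
destruct (Hu (clamp t) (clamp_range t) e He) as [d [Hd h]].
exists d. split; [exact Hd|]. intros y Hy. apply h; [apply clamp_range|].
eapply Rle_lt_trans; [apply clamp_lip|exact Hy].
Qed.

Lemma clamp_derivable u t l : 0 < t < 1 -> is_derive u t l ->
  derivable_pt_lim (fun x => u (clamp x)) t l.
Proof.
intros Ht Hu. apply is_derive_Reals. apply (is_derive_ext_loc u); [|exact Hu].
assert (He : 0 < Rmin t (1 - t)) by (apply Rmin_glb_lt; lra).
exists (mkposreal _ He). intros x Hx.
change (Rabs (x - t) < Rmin t (1 - t)) in Hx.
assert (a := Rmin_l t (1 - t)). assert (b := Rmin_r t (1 - t)).
apply Rabs_def2 in Hx. rewrite clamp_id; [reflexivity|lra].
Qed.

(** The eigenfunction is multiplied by 1 or -1 and clamped. Its derivative psi remains uncontrolled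
    at 0 and 1, because [C2_open01] speaks of the open interval. *)
Lemma eigenfunction_positive_somewhere m lam : is_eigenvalue m lam ->
  exists phi psi, continuity phi /\ phi 0 = 0 /\ phi 1 = 0 /\
    (forall t, 0 < t < 1 -> derivable_pt_lim phi t (psi t) /\
       derivable_pt_lim psi t (- (lam * m t * phi t))) /\
    exists t, 0 < t < 1 /\ 0 < phi t.
Proof.
intros [u [u'' [cu [[u' Hu'] [Heq [u0 [u1 [t [Ht Hut]]]]]]]]].
assert (Ht' : 0 < t < 1).
{ split; apply Rnot_le_lt; intros h.
  - assert (t = 0) by lra. subst; contradiction.
  - assert (t = 1) by lra. subst; contradiction. }
assert (G : forall sg, 0 < sg * u t -> exists phi psi, continuity phi /\ phi 0 = 0 /\ phi 1 = 0 /\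
    (forall t, 0 < t < 1 -> derivable_pt_lim phi t (psi t) /\
       derivable_pt_lim psi t (- (lam * m t * phi t))) /\
    exists t, 0 < t < 1 /\ 0 < phi t).
{ intros sg Hsg. exists (fun x => sg * u (clamp x)), (fun x => sg * u' x).
  split; [apply (continuity_scal (fun x => u (clamp x))), clamp_continuous, cu|].
  rewrite !clamp_id by lra. split; [rewrite u0; ring|]. split; [rewrite u1; ring|]. split.
  - intros x Hx. destruct (Hu' x Hx) as [d1 [d2 _]]. split.
    + apply (derivable_pt_lim_scal (fun x => u (clamp x))), clamp_derivable; assumption.
    + rewrite clamp_id by lra.
      replace (- (lam * m x * (sg * u x))) with (sg * u'' x).
      * apply (derivable_pt_lim_scal u'), is_derive_Reals, d2.
      * assert (q := Heq x Hx). replace (u'' x) with (- (lam * m x * u x)) by lra. ring.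
  - exists t. split; [exact Ht'|]. rewrite clamp_id by exact Ht. exact Hsg. }
destruct (Rlt_or_le 0 (u t)) as [h|h]; [apply (G 1); lra|apply (G (-1)); lra].
Qed.

(* Wronskian of a solution and a lam1-eigenfunction over one of its nodal
   intervals: the growth condition makes the Wronskian decrease by a multiple of
   the size of the solution, while its boundary values have a sign. *)
Lemma a_priori_bound H m beta lam1 Rr :
  (forall t u, 0 <= H t u) -> continuity m -> (forall t, 0 <= m t) ->
  is_eigenvalue m lam1 -> 0 < lam1 < beta -> 0 < Rr ->
  (forall t u, 0 < t < 1 -> Rr <= u -> beta * m t * u <= H t u) ->
  exists M, forall s V W, ivp_sol H 1 s V W -> 0 <= V 1 ->
    forall t, 0 <= t <= 1 -> V t <= M.
Proof.
intros H0 Hm Hm0 Heig Hl HR Hlarge.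
destruct (eigenfunction_positive_somewhere m lam1 Heig)
  as [phi [psi [cphi [phi0 [phi1 [Dphi [ts [Hts Hphits]]]]]]]].
destruct (nodal_interval phi ts cphi Hts phi0 phi1 Hphits) as [a [b [Ha [Hb [pa [pb Hpos]]]]]].
assert (cpsi : forall x, 0 < x < 1 -> continuity_pt psi x).
{ intros x Hx. apply derivable_continuous_pt. exists (- (lam1 * m x * phi x)). apply Dphi, Hx. }
(* Since m may vanish on part of (a, b), a point with m phi > 0 has to be found: phi rises from a to
   ts and falls from ts to b, so psi decreases somewhere between. *)
assert (Hcore : exists c, a < c < b /\ 0 < m c * phi c).
{ destruct (mvt_open phi psi a ts) as [c1 [hc1 e1]];
    [lra|intros; apply cphi|intros x hx; apply Dphi; lra|].
  destruct (mvt_open phi psi ts b) as [c2 [hc2 e2]];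
    [lra|intros; apply cphi|intros x hx; apply Dphi; lra|].
  destruct (mvt_open psi (fun x => - (lam1 * m x * phi x)) c1 c2) as [c [hc e]];
    [lra|intros; apply cpsi; lra|intros x hx; apply Dphi; lra|].
  exists c. split; [lra|].
  assert (k1 : 0 < psi c1) by nra. assert (k2 : psi c2 < 0) by nra.
  assert (k3 : 0 < lam1 * m c * phi c) by nra. rewrite Rmult_assoc in k3.
  apply (Rmult_lt_reg_l lam1); lra. }
destruct Hcore as [c [Hc Hmc]].
set (kappa := m c * phi c / 2). assert (Hkappa : 0 < kappa) by (unfold kappa; lra).
destruct (continuity_pt_eps (fun x => m x * phi x) c) with (e := kappa) as [d [Hd hd]].
{ apply continuity_pt_mult; [apply Hm|apply cphi]. }
{ exact Hkappa. }
set (eta := Rmin (d / 2) (Rmin ((c - a) / 2) ((b - c) / 2))).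
assert (Heta : 0 < eta) by (unfold eta; repeat apply Rmin_glb_lt; lra).
assert (eta1 : eta <= d / 2) by apply Rmin_l.
assert (eta2 : eta <= (c - a) / 2) by (eapply Rle_trans; [apply Rmin_r|apply Rmin_l]).
assert (eta3 : eta <= (b - c) / 2) by (eapply Rle_trans; [apply Rmin_r|apply Rmin_r]).
destruct (continuity_bounded m Hm) as [Km [Km0 HKm]].
destruct (continuity_bounded phi cphi) as [Kp [Kp0 HKp]].
(* [C0] bounds beta m V phi wherever V < Rr, that is, where the growth condition says nothing. *)
set (C0 := beta * Km * Rr * Kp).
(* The distance from the window (c - eta, c + eta) to the ends 0 and 1: a concave V that is
   nonnegative at both ends is at least rho V(t1) on the window. *)
set (rho := Rmin (c - eta) (1 - (c + eta))).
assert (Hrho : 0 < rho) by (apply Rmin_glb_lt; lra).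
assert (rho1 : rho <= c - eta) by apply Rmin_l.
assert (rho2 : rho <= 1 - (c + eta)) by apply Rmin_r.
set (den := 2 * eta * (kappa * (beta - lam1) * rho)).
assert (Hkb : 0 < kappa * (beta - lam1)) by (apply Rmult_lt_0_compat; lra).
assert (Hkbr : 0 < kappa * (beta - lam1) * rho) by (apply Rmult_lt_0_compat; lra).
assert (Hden : 0 < den) by (unfold den; apply Rmult_lt_0_compat; lra).
(* The Wronskian Z changes by at most C0 - den V(t1) between a point near a and a point near b: C0
   for a length at most 1, and den V(t1) for the decrease on the window. Its values near a and b
   force a change of at least -2. *)
exists ((C0 + 2) / den). intros s V W sol HV1 t1 Ht1.
assert (ch := chord_le H0 Rle_0_1 sol). assert (sl := slope_le H0 Rle_0_1 sol).
destruct (sol_init sol) as [V0 W0].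
destruct sol as [cV [cW [_ [_ D]]]].
assert (HV : forall x, 0 <= x <= 1 -> 0 <= V x).
{ intros x hx. assert (q := ch 0 x 1 ltac:(lra) ltac:(lra)). nra. }
assert (HVm : forall x, c - eta < x < c + eta -> rho * V t1 <= V x).
{ intros x hx. assert (h1 := HV t1 Ht1).
  destruct (Rle_or_lt x t1) as [h|h].
  - assert (q := ch 0 x t1 ltac:(lra) ltac:(lra)). rewrite V0 in q.
    assert (h2 := HV x ltac:(lra)).
    apply Rle_trans with (x * V t1); [apply Rmult_le_compat_r; lra|]. nra.
  - assert (q := ch t1 x 1 ltac:(lra) ltac:(lra)).
    assert (h2 := HV x ltac:(lra)).
    apply Rle_trans with ((1 - x) * V t1); [apply Rmult_le_compat_r; lra|]. nra. }
(* B depends on the solution, but it serves only to choose points so close to a and b that |W phi|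
   <= 1; the bound M stays independent of s. *)
set (B := Rabs (W 0) + Rabs (W 1) + 1).
assert (HB : 0 < B) by (unfold B; generalize (Rabs_pos (W 0)) (Rabs_pos (W 1)); lra).
assert (HWB : forall x, 0 <= x <= 1 -> Rabs (W x) <= B).
{ intros x hx. assert (h1 := sl 0 x ltac:(lra) ltac:(lra)). assert (h2 := sl x 1 ltac:(lra) ltac:(lra)).
  apply Rabs_le. unfold B.
  generalize (Rle_abs (W 0)) (Rle_abs (- W 1)) (Rabs_pos (W 0)) (Rabs_pos (W 1)). rewrite Rabs_Ropp. lra. }
assert (HiB : 0 < / B) by (apply Rinv_0_lt_compat, HB).
assert (HWphi : forall x, 0 <= x <= 1 -> Rabs (phi x) < / B -> Rabs (W x * phi x) <= 1).
{ intros x hx hp. rewrite Rabs_mult. rewrite <- (Rinv_r B) by lra.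
  apply Rmult_le_compat; [apply Rabs_pos|apply Rabs_pos|apply HWB, hx|lra]. }
set (Z := fun x => W x * phi x - V x * psi x).
assert (DZ : forall x, 0 < x < 1 -> derivable_pt_lim Z x
  (- (1 * H x (V x)) * phi x - V x * - (lam1 * m x * phi x))).
{ intros x hx. destruct (D x hx) as [D1 D2]. destruct (Dphi x hx) as [D3 D4].
  apply derivable_pt_lim_wronskian; assumption. }
assert (HZ' : forall x, a < x < b -> - (1 * H x (V x)) * phi x - V x * - (lam1 * m x * phi x)
   <= C0 - (beta - lam1) * (m x * phi x) * V x).
{ intros x hx. assert (p := Hpos x hx). assert (v := HV x ltac:(lra)).
  assert (mx := Hm0 x).
  assert (mK : m x <= Km) by (eapply Rle_trans; [apply Rle_abs|apply HKm; lra]).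
  assert (pK : phi x <= Kp) by (eapply Rle_trans; [apply Rle_abs|apply HKp; lra]).
  assert (hC : 0 <= C0) by (unfold C0; repeat apply Rmult_le_pos; lra).
  destruct (Rle_or_lt Rr (V x)) as [h|h].
  - assert (q := Rmult_le_compat_r (phi x) _ _ (Rlt_le _ _ p) (Hlarge x (V x) ltac:(lra) h)). lra.
  - assert (q : beta * m x * V x * phi x <= C0).
    { unfold C0. repeat (apply Rmult_le_compat; try lra; try (repeat apply Rmult_le_pos; lra)). }
    assert (q' := Rmult_le_pos _ _ (H0 x (V x)) (Rlt_le _ _ p)). lra. }
assert (Zmvt : forall x y k, a < x <= y -> y < b ->
  (forall z, x < z < y -> - (1 * H z (V z)) * phi z - V z * - (lam1 * m z * phi z) <= k) ->
  Z y - Z x <= k * (y - x)).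
{ intros x y k hx hy hk. destruct (Req_dec x y) as [<-|hne]; [lra|].
  destruct (mvt_open Z (fun x => - (1 * H x (V x)) * phi x - V x * - (lam1 * m x * phi x)) x y)
    as [z [hz e]]; [lra| |intros; apply DZ; lra|].
  - intros z hz. apply derivable_continuous_pt. eexists. apply DZ. lra.
  - rewrite e. apply Rmult_le_compat_r; [lra|]. apply hk, hz. }
assert (Ea : exists x, a < x < c - eta /\ Z x <= 1).
{ destruct (continuity_pt_eps phi a (cphi a) (/ B) HiB) as [da [Hda hda]].
  set (r := Rmin da (c - eta - a)).
  assert (r0 : 0 < r) by (apply Rmin_glb_lt; lra).
  assert (r1 : r <= da) by apply Rmin_l. assert (r2 : r <= c - eta - a) by apply Rmin_r.
  destruct (mvt_open phi psi a (a + r)) as [x [hx e]];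
    [lra|intros; apply cphi|intros x hx; apply Dphi; lra|].
  assert (p := Hpos (a + r) ltac:(lra)).
  exists x. split; [lra|].
  assert (q := hda x ltac:(apply Rabs_def1; lra)). rewrite pa, Rminus_0_r in q.
  assert (q' := HWphi x ltac:(lra) q). apply Rabs_le_between in q'.
  assert (hpsi : 0 < psi x) by nra.
  assert (hv := Rmult_le_pos _ _ (HV x ltac:(lra)) (Rlt_le _ _ hpsi)). unfold Z. lra. }
assert (Eb : exists x, c + eta < x < b /\ -1 <= Z x).
{ destruct (continuity_pt_eps phi b (cphi b) (/ B) HiB) as [da [Hda hda]].
  set (r := Rmin da (b - (c + eta))).
  assert (r0 : 0 < r) by (apply Rmin_glb_lt; lra).
  assert (r1 : r <= da) by apply Rmin_l. assert (r2 : r <= b - (c + eta)) by apply Rmin_r.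
  destruct (mvt_open phi psi (b - r) b) as [x [hx e]];
    [lra|intros; apply cphi|intros x hx; apply Dphi; lra|].
  assert (p := Hpos (b - r) ltac:(lra)).
  exists x. split; [lra|].
  assert (q := hda x ltac:(apply Rabs_def1; lra)). rewrite pb, Rminus_0_r in q.
  assert (q' := HWphi x ltac:(lra) q). apply Rabs_le_between in q'.
  assert (hpsi : psi x < 0) by nra.
  assert (hv := Rmult_le_pos _ (- psi x) (HV x ltac:(lra)) ltac:(lra)). unfold Z. lra. }
destruct Ea as [a' [Ha' HZa]]. destruct Eb as [b' [Hb' HZb]].
assert (HC0 : 0 <= C0) by (unfold C0; repeat apply Rmult_le_pos; lra).
assert (Hout : forall x, a < x < b -> - (1 * H x (V x)) * phi x - V x * - (lam1 * m x * phi x) <= C0).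
{ intros x hx. eapply Rle_trans; [apply HZ', hx|].
  assert (q : 0 <= (beta - lam1) * (m x * phi x) * V x).
  { apply Rmult_le_pos; [|apply HV; lra]. apply Rmult_le_pos; [lra|].
    apply Rmult_le_pos; [apply Hm0|apply Rlt_le, Hpos, hx]. }
  lra. }
assert (I1 := Zmvt a' (c - eta) C0 ltac:(lra) ltac:(lra) ltac:(intros z hz; apply Hout; lra)).
assert (I3 := Zmvt (c + eta) b' C0 ltac:(lra) ltac:(lra) ltac:(intros z hz; apply Hout; lra)).
assert (I2 := Zmvt (c - eta) (c + eta) (C0 - kappa * (beta - lam1) * rho * V t1) ltac:(lra) ltac:(lra)).
assert (I2' : Z (c + eta) - Z (c - eta) <= (C0 - kappa * (beta - lam1) * rho * V t1) * (c + eta - (c - eta))).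
{ apply I2. intros z hz. eapply Rle_trans; [apply HZ'; lra|].
  assert (q := hd z ltac:(apply Rabs_def1; lra)). apply Rabs_def2 in q.
  assert (q' : kappa <= m z * phi z) by (unfold kappa in *; lra).
  assert (q2 : kappa * (rho * V t1) <= (m z * phi z) * V z).
  { apply Rmult_le_compat; [lra|apply Rmult_le_pos; [lra|apply HV, Ht1]|exact q'|apply HVm, hz]. }
  assert (q3 := Rmult_le_compat_l (beta - lam1) _ _ ltac:(lra) q2). lra. }
apply (Rmult_le_reg_l den); [exact Hden|].
replace (den * ((C0 + 2) / den)) with (C0 + 2) by (field; lra).
assert (Hlen : C0 * (b' - a') <= C0 * 1) by (apply Rmult_le_compat_l; lra).
unfold den. lra.
Qed.

(** If V 1 >= 0, then V <= M with M independent of s, so H <= K along the solution and its slope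
    stays at least s - K > M; this gives V 1 > M, a contradiction. *)
Lemma large_slope_negative H m beta lam1 Rr s0 :
  (forall t u, 0 <= H t u) -> bounded_left H -> continuity m -> (forall t, 0 <= m t) ->
  is_eigenvalue m lam1 -> 0 < lam1 < beta -> 0 < Rr ->
  (forall t u, 0 < t < 1 -> Rr <= u -> beta * m t * u <= H t u) ->
  exists s, s0 <= s /\ forall V W, ivp_sol H 1 s V W -> V 1 < 0.
Proof.
intros H0 HB Hm Hm0 Heig Hl HR Hlarge.
destruct (a_priori_bound H m beta lam1 Rr H0 Hm Hm0 Heig Hl HR Hlarge) as [M HM].
destruct (HB M) as [K HK].
exists (Rmax s0 (M + K + 1)). split; [apply Rmax_l|].
intros V W sol. apply Rnot_le_lt. intros HV1.
assert (hM := HM _ V W sol HV1).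
assert (tb := tangent_bounds H0 Rle_0_1 sol 0 1 ltac:(lra) ltac:(lra)).
destruct (sol_init sol) as [V0 W0].
destruct sol as [cV [cW [_ [_ D]]]].
destruct (mvt_open W (fun t => - (1 * H t (V t))) 0 1) as [c [Hc E]];
  [lra | intros; apply cW | intros x Hx; apply D; lra |].
assert (h := HK c (V c) ltac:(lra) (hM c ltac:(lra))).
assert (h1 := hM 1 ltac:(lra)).
assert (h2 := Rmax_r s0 (M + K + 1)). lra.
Qed.

(** The linear growth rate crosses [lam1] from alpha near u = 0 to beta for large u; the slopes
    [delta / 2] and S at the two ends of the shooting interval feel these two rates. *)
Lemma positive_solution_of_crossing H m alpha beta lam1 delta Rr :
  jcont H -> (forall t u, 0 <= H t u) -> bounded_left H -> (forall t u, u <= 0 -> H t u = 0) ->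
  continuity m -> (forall t, 0 <= m t) -> is_first_eigenvalue m lam1 ->
  0 <= alpha < lam1 -> lam1 < beta -> 0 < delta -> 0 < Rr ->
  (forall t u, 0 < t < 1 -> 0 < u < delta -> H t u <= alpha * m t * u) ->
  (forall t u, 0 < t < 1 -> Rr <= u -> beta * m t * u <= H t u) ->
  exists s V W, ivp_sol H 1 s V W /\ V 1 = 0 /\ forall t, 0 < t < 1 -> 0 < V t.
Proof.
intros HC H0 HB Hneg Hm Hm0 Hfirst Ha Hb Hd HR Hsmall Hlarge.
destruct (large_slope_negative H m beta lam1 Rr (delta / 2) H0 HB Hm Hm0 (proj1 Hfirst)
  ltac:(lra) HR Hlarge) as [S [HS HSneg]].
destruct (shooting H (fun _ => 1) id (delta / 2) S 1 S) as [s [V [W [Hs [sol HV1]]]]];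
  try assumption.
- apply continuity_const. intros x y; reflexivity.
- apply derivable_continuous, derivable_id.
- intros p Hp. unfold id. lra.
- intros V W. apply (small_slope_positive H m alpha lam1 delta); try assumption. unfold id; lra.
- exists s, V, W. split; [exact sol|]. split; [exact HV1|].
  apply (pos_inside H0 Rle_0_1 sol); [unfold id; lra|]. rewrite HV1. lra.
Qed.

(** * The radial problem *)

(** Since H vanishes for u <= 0, only the compact rectangle [0, 1] x [0, max(0, S)] matters; points
    where H exceeds n would have an ultrafilter limit there at which continuity fails. *)
Lemma jcont_bounded_left H : jcont H -> (forall t u, u <= 0 -> H t u = 0) -> bounded_left H.
Proof.
intros HC Hneg S. apply NNPP. intros Hno.
assert (Hbad : forall n : nat, exists p : R * R,
  (0 <= fst p <= 1 /\ 0 <= snd p <= Rmax 0 S) /\ INR n < H (fst p) (snd p)).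
{ intros n. apply NNPP. intros Hn. apply Hno. exists (INR n). intros t u Ht Hu.
  apply Rnot_lt_le. intros h. apply Hn. exists (t, u). simpl.
  assert (q := pos_INR n).
  assert (hu : 0 < u).
  { apply Rnot_le_lt. intros hu. rewrite Hneg in h by exact hu. lra. }
  assert (q' := Rmax_r 0 S). lra. }
pose (p := fun n => proj1_sig (constructive_indefinite_description _ (Hbad n))).
assert (Hp : forall n, (0 <= fst (p n) <= 1 /\ 0 <= snd (p n) <= Rmax 0 S) /\ INR n < H (fst (p n)) (snd (p n))).
{ intros n. exact (proj2_sig (constructive_indefinite_description _ (Hbad n))). }
destruct free_ultrafilter_exists as [U HU].
destruct (ulim_exists U HU (fun n => fst (p n)) 1) as [t Ht].
{ intros n. destruct (Hp n) as [[h _] _]. rewrite Rabs_pos_eq; lra. }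
destruct (ulim_exists U HU (fun n => snd (p n)) (Rmax 0 S)) as [u Hu].
{ intros n. destruct (Hp n) as [[_ h] _]. rewrite Rabs_pos_eq; lra. }
destruct (HC t u 1 Rlt_0_1) as [d [Hd hd]].
destruct (INR_unbounded (H t u + 1)) as [N HN].
destruct (uf_ex _ HU _ (uf_and _ HU _ _ (uf_tail _ HU N) (uf_and _ HU _ _ (Ht d Hd) (Hu d Hd))))
  as [n [h1 [h2 h3]]].
assert (q := hd _ _ h2 h3). apply Rabs_def2 in q. apply le_INR in h1.
destruct (Hp n) as [_ h4]. lra.
Qed.

Lemma cont_on_closed_of_pt f a b : (forall t, a <= t <= b -> continuity_pt f t) -> cont_on_closed a b f.
Proof.
intros Hf t Ht e He. destruct (continuity_pt_eps f t (Hf t Ht) e He) as [d [Hd h]].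
exists d. split; [exact Hd|]. intros s _ Hs. apply h, Hs.
Qed.

Lemma continuity_pt_of_ex_derive f t : ex_derive f t -> continuity_pt f t.
Proof. intros Hf. apply derivable_continuous_pt, ex_derive_Reals_0, Hf. Qed.

(** With a = r1^(N-2) and b = r2^(N-2), the quotient A / (B - t) equals a b / (b - t (b - a)), the
    harmonic mean of a and b with weights 1 - t and t. *)
Lemma coef_bounds N r1 r2 t : 0 < r1 -> r1 < r2 -> (2 < N)%nat -> 0 <= t <= 1 ->
  0 < coefB N r1 r2 - t /\
  r1 ^ (N - 2) <= coefA N r1 r2 / (coefB N r1 r2 - t) <= r2 ^ (N - 2).
Proof.
intros H1 H2 HN Ht. unfold coefA, coefB. rewrite Rpow_mult_distr.
assert (Ha : 0 < r1 ^ (N - 2)) by (apply pow_lt; lra).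
assert (Hab : r1 ^ (N - 2) < r2 ^ (N - 2)).
{ rewrite <- !Rpower_pow by lra. apply Rlt_Rpower_l; [apply lt_0_INR; lia|lra]. }
set (a := r1 ^ (N - 2)) in *. set (b := r2 ^ (N - 2)) in *.
assert (Hden1 : a <= b - t * (b - a)) by nra.
assert (Hden2 : b - t * (b - a) <= b) by nra.
assert (Hden : 0 < b - t * (b - a)) by lra.
assert (E : b / (b - a) - t = (b - t * (b - a)) / (b - a)) by (field; lra).
rewrite E. split; [apply Rdiv_lt_0_compat; lra|].
replace (a * b / (b - a) / ((b - t * (b - a)) / (b - a))) with (a * b / (b - t * (b - a)))
  by (field; lra).
split; apply (Rmult_le_reg_r (b - t * (b - a))); try exact Hden;
  replace (a * b / (b - t * (b - a)) * (b - t * (b - a))) with (a * b) by (field; lra); nra.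
Qed.

Lemma exp_le_compat x y : x <= y -> exp x <= exp y.
Proof. intros [h|<-]; [apply Rlt_le, exp_increasing, h|apply Rle_refl]. Qed.

Lemma radius_range N r1 r2 t : 0 < r1 -> r1 < r2 -> (2 <= N)%nat -> 0 <= t <= 1 ->
  r1 <= radius N r1 r2 t <= r2.
Proof.
intros H1 H2 HN Ht. unfold radius. destruct (Nat.eqb_spec N 2) as [_|Hne].
- assert (Hq : 0 < r1 / r2) by (apply Rdiv_lt_0_compat; lra).
  assert (Hl : ln (r1 / r2) <= 0).
  { rewrite <- ln_1. apply ln_le; [exact Hq|]. apply (Rmult_le_reg_r r2); [lra|].
    replace (r1 / r2 * r2) with r1 by (field; lra). lra. }
  assert (h1 : Rpower (r1 / r2) t <= 1).
  { unfold Rpower. rewrite <- exp_0. apply exp_le_compat. nra. }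
  assert (h2 : r1 / r2 <= Rpower (r1 / r2) t).
  { rewrite <- (exp_ln (r1 / r2)) at 1 by exact Hq. apply exp_le_compat. nra. }
  assert (h3 := Rmult_le_compat_l r2 _ _ ltac:(lra) h2).
  replace (r2 * (r1 / r2)) with r1 in h3 by (field; lra). split; nra.
- destruct (coef_bounds N r1 r2 t H1 H2 ltac:(lia) Ht) as [_ h].
  assert (Hk : 0 < INR (N - 2)) by (apply lt_0_INR; lia).
  assert (Hroot : forall r, 0 < r -> Rpower (r ^ (N - 2)) (1 / INR (N - 2)) = r).
  { intros r Hr. rewrite <- Rpower_pow, Rpower_mult by exact Hr.
    replace (INR (N - 2) * (1 / INR (N - 2))) with 1 by (field; lra). apply Rpower_1, Hr. }
  assert (Hi : 0 <= 1 / INR (N - 2)) by (apply Rlt_le, Rdiv_lt_0_compat; lra).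
  assert (p := pow_lt r1 (N - 2) H1).
  split.
  + rewrite <- (Hroot r1 H1) at 1. apply Rle_Rpower_l; [exact Hi|lra].
  + apply Rle_trans with (Rpower (r2 ^ (N - 2)) (1 / INR (N - 2))).
    * apply Rle_Rpower_l; [exact Hi|lra].
    * apply Req_le, Hroot. lra.
Qed.

Lemma radius_continuous N r1 r2 : 0 < r1 -> r1 < r2 -> (2 <= N)%nat ->
  cont_on_closed 0 1 (radius N r1 r2).
Proof.
intros H1 H2 HN. apply cont_on_closed_of_pt. intros t Ht. apply continuity_pt_of_ex_derive.
unfold radius. destruct (Nat.eqb_spec N 2) as [_|Hne].
- unfold Rpower. auto_derive. exact I.
- destruct (coef_bounds N r1 r2 t H1 H2 ltac:(lia) Ht) as [hB [hq _]].
  assert (p := pow_lt r1 (N - 2) H1).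
  unfold Rpower. auto_derive. split; [apply Rgt_not_eq; lra|]. split; [|exact I].
  exact (Rlt_le_trans _ _ _ p hq).
Qed.

Lemma qfun_continuous N r1 r2 : 0 < r1 -> r1 < r2 -> (2 <= N)%nat ->
  cont_on_closed 0 1 (qfun N r1 r2).
Proof.
intros H1 H2 HN. apply cont_on_closed_of_pt. intros t Ht. apply continuity_pt_of_ex_derive.
unfold qfun. destruct (Nat.eqb_spec N 2) as [_|Hne].
- unfold Rpower. auto_derive. exact I.
- destruct (coef_bounds N r1 r2 t H1 H2 ltac:(lia) Ht) as [hB _].
  unfold Rpower. auto_derive. split; [lra|]. split; [|exact I].
  apply Rgt_not_eq, exp_pos.
Qed.

Lemma qfun_nonneg N r1 r2 t : (2 <= N)%nat -> 0 <= qfun N r1 r2 t.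
Proof.
intros HN. unfold qfun. destruct (Nat.eqb_spec N 2) as [_|Hne].
- apply pow2_ge_0.
- apply Rlt_le. unfold Rdiv. repeat apply Rmult_lt_0_compat.
  + apply Rinv_0_lt_compat, pow_lt, lt_0_INR. lia.
  + apply exp_pos.
  + apply Rinv_0_lt_compat, exp_pos.
Qed.

(** Carries [lam1] over from the weight q b to its clamped extension to the line. *)
Lemma is_eigenvalue_ext m m' lam : (forall t, 0 < t < 1 -> m t = m' t) ->
  is_eigenvalue m lam -> is_eigenvalue m' lam.
Proof.
intros E [u [u'' [c1 [c2 [heq h]]]]]. exists u, u''.
split; [exact c1|]. split; [exact c2|]. split; [|exact h].
intros t Ht. rewrite <- E by exact Ht. apply heq, Ht.
Qed.

Lemma jcont_superposition r1 r2 h rad :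
  cont_on_dom r1 r2 h -> continuity rad -> (forall t, r1 <= rad t <= r2) ->
  jcont (fun t u => h (rad t) (Rmax 0 u)).
Proof.
intros Hh Hc Hr t u e He.
destruct (Hh (rad t) (Rmax 0 u) (Hr t) (Rmax_l _ _) e He) as [d [Hd hd]].
destruct (continuity_pt_eps rad t (Hc t) d Hd) as [d' [Hd' hd']].
exists (Rmin d d'). split; [apply Rmin_glb_lt; assumption|].
intros t' u' Ht Hu. apply hd; [apply Hr|apply Rmax_l| |].
- apply hd'. exact (Rlt_le_trans _ _ _ Ht (Rmin_r _ _)).
- eapply Rle_lt_trans; [apply Rmax_0_lip|]. exact (Rlt_le_trans _ _ _ Hu (Rmin_l _ _)).
Qed.

Theorem theorem1p5 (r1 r2 : R) (N : nat) (h : R -> R -> R)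
  (b : R -> R) (c delta Rr lam1 : R) :
  0 < r1 -> r1 < r2 -> (2 <= N)%nat ->
  cont_on_dom r1 r2 h ->
  (forall t u, r1 <= t <= r2 -> 0 <= u -> 0 <= h t u) ->
  (forall t, r1 <= t <= r2 -> h t 0 = 0) ->
  cont_on_closed 0 1 b ->
  (forall t, 0 <= t <= 1 -> 0 <= b t) ->
  (exists t, 0 <= t <= 1 /\ b t <> 0) ->
  1 < c -> 0 < delta -> delta < Rr ->
  (forall t u, 0 < t < 1 -> 0 < u < delta ->
     ffun N r1 r2 h t u <= b t * u) ->
  (forall t u, 0 < t < 1 -> Rr <= u ->
     c * b t * u <= ffun N r1 r2 h t u) ->
  is_first_eigenvalue (fun t => qfun N r1 r2 t * b t) lam1 ->
  forall lam, lam1 / c < lam < lam1 ->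
    exists u, positive_solution (qfun N r1 r2) (ffun N r1 r2 h) lam u.
Proof.
intros Hr1 Hr12 HN Hh Hh0 Hhz Hb Hb0 _ Hc Hd HdR Hsmall Hlarge Hfirst lam Hlam.
(* Positivity of [lam1] is read off from lam1 / c < lam1 with c > 1. *)
assert (Hl1 : 0 < lam1).
{ assert (q : lam1 < c * lam1); [|nra].
  replace lam1 with (c * (lam1 / c)) at 1 by (field; lra). apply Rmult_lt_compat_l; lra. }
assert (Hl0 : 0 < lam1 / c) by (apply Rdiv_lt_0_compat; lra).
assert (Hlc : lam1 < lam * c).
{ replace lam1 with (lam1 / c * c) by (field; lra). apply Rmult_lt_compat_r; lra. }
(* Clamping t and truncating u keep the arguments of h in its domain; h(t, 0) = 0 makes H vanish for
   u <= 0. *)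
set (q := fun t => qfun N r1 r2 (clamp t)).
set (rad := fun t => radius N r1 r2 (clamp t)).
set (m := fun t => q t * b (clamp t)).
set (H := fun t u => lam * q t * h (rad t) (Rmax 0 u)).
assert (cq : continuity q) by (apply clamp_continuous, qfun_continuous; assumption).
assert (crad : continuity rad) by (apply clamp_continuous, radius_continuous; assumption).
assert (q0 : forall t, 0 <= q t) by (intros t; apply qfun_nonneg; assumption).
assert (Hrad : forall t, r1 <= rad t <= r2)
  by (intros t; apply radius_range; try assumption; apply clamp_range).
assert (cm : continuity m).
{ apply (continuity_mult q (fun t => b (clamp t))); [exact cq|]. apply clamp_continuous, Hb. }
assert (m0 : forall t, 0 <= m t).
{ intros t. apply Rmult_le_pos; [apply q0|apply Hb0, clamp_range]. }
assert (HC : jcont H).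
{ apply (jcont_mult (fun t _ => lam * q t) (fun t u => h (rad t) (Rmax 0 u))).
  - apply jcont_fst, (continuity_scal q), cq.
  - apply (jcont_superposition r1 r2); assumption. }
assert (H0 : forall t u, 0 <= H t u).
{ intros t u. apply Rmult_le_pos; [apply Rmult_le_pos; [lra|apply q0]|].
  apply Hh0; [apply Hrad|apply Rmax_l]. }
assert (Hneg : forall t u, u <= 0 -> H t u = 0).
{ intros t u Hu. unfold H. rewrite Rmax_left by exact Hu. rewrite Hhz by apply Hrad. ring. }
assert (HE : forall t u, 0 < t < 1 -> 0 <= u -> H t u = lam * qfun N r1 r2 t * ffun N r1 r2 h t u).
{ intros t u Ht Hu. unfold H, q, rad, ffun. rewrite clamp_id, Rmax_right by lra. reflexivity. }
assert (mE : forall t, 0 < t < 1 -> qfun N r1 r2 t * b t = m t).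
{ intros t Ht. unfold m, q. rewrite clamp_id by lra. reflexivity. }
(* With lam inside H, the growth rates are alpha = lam and beta = lam c, and the assumed range of
   lam says exactly alpha < lam1 < beta. *)
destruct (positive_solution_of_crossing H m lam (lam * c) lam1 delta Rr)
  as [s [V [W [sol [V1 Vpos]]]]]; try assumption; try lra.
- apply jcont_bounded_left; assumption.
- destruct Hfirst as [e1 e2]. split; [exact (is_eigenvalue_ext _ _ _ mE e1)|].
  intros mu Hmu. apply e2. apply (is_eigenvalue_ext m); [|exact Hmu].
  intros t Ht. symmetry. apply mE, Ht.
- intros t u Ht Hu. rewrite HE, <- mE by lra.
  replace (lam * (qfun N r1 r2 t * b t) * u) with (lam * qfun N r1 r2 t * (b t * u)) by ring.
  apply Rmult_le_compat_l; [apply Rmult_le_pos; [lra|apply qfun_nonneg, HN]|].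
  apply Hsmall; assumption.
- intros t u Ht Hu. rewrite HE, <- mE by lra.
  replace (lam * c * (qfun N r1 r2 t * b t) * u) with (lam * qfun N r1 r2 t * (c * b t * u)) by ring.
  apply Rmult_le_compat_l; [apply Rmult_le_pos; [lra|apply qfun_nonneg, HN]|].
  apply Hlarge; assumption.
- destruct (ivp_C2 H 1 s V W HC sol) as [c1 c2].
  exists V, (fun t => - (1 * H t (V t))).
  split; [exact c1|]. split; [exact c2|].
  split; [|split; [exact (proj1 (sol_init sol))|split; [exact V1|exact Vpos]]].
  intros t Ht. rewrite HE by (try exact Ht; apply Rlt_le, Vpos, Ht). ring.
Qed.
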